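(* Fix any positive integer $d$. Let $S\subset\mathbb{Z}^n$ be a finite set of integer points and $W$ an integer $d\times n$ matrix. Then the polytope ${\rm conv}(WS)={\rm conv}\{Wx : x\in S\}\subset\mathbb{R}^d$ has $O\left((e(S)\cdot \|W\|_\infty)^{d(d-1)}\right)$ vertices (in particular polynomially many). Moreover, if $S$ is presented by a linear-optimization oracle and endowed with an upper bound $e$ on $e(S)$, then all vertices of ${\rm conv}(WS)$ can be enumerated, and the problem $\max\{f(Wx) : x\in S\}$ can be solved for every convex function $f:\mathbb{R}^d\rightarrow\mathbb{R}$ presented by a comparison oracle, in polynomial time (polynomial in $n$, $e$ and $\|W\|_\infty$, with a polynomial number of queries to the oracles).
   Context: For a matrix $W$, $\|W\|_\infty:=\max_{i,j}|W_{i,j}|$. The edge complexity $e(P)$ of a rational polytope $P$ is the smallest nonnegative integer such that every edge (1-dimensional face) of $P$ is parallel to some integer vector $v$ with $\|v\|_1\le e(P)$; for a finite set $S$ of rational points, $e(S):=e({\rm conv}(S))$. A linear-optimization oracle for $S$ is one that, queried on $w\in\mathbb{Z}^n$, returns a solution of $\max\{wx : x\in S\}$. A comparison oracle for $f$ is one that, queried on $y,z\in\mathbb{R}^d$, asserts whether or not $f(y)<f(z)$. The dimension $d$ is fixed (constants in the $O$ and the polynomial may depend on $d$).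
   Formalization: The vertex bound is proved with max(1, e(S)·‖W‖∞) in place of e(S)·‖W‖∞; the literal bound fails when this product is 0 and d ≥ 2 (e.g. S={0}, W=0: one vertex, bound 0), and the two agree otherwise. *)

(* Defs.v *)
From HB Require Import structures.
From mathcomp Require Import all_boot all_order all_algebra.
From mathcomp Require Import all_classical all_reals all_analysis.

Set Implicit Arguments.
Unset Strict Implicit.
Unset Printing Implicit Defensive.

Import Order.TTheory GRing.Theory Num.Theory.
Local Open Scope classical_set_scope.
Local Open Scope ring_scope.

Notation to_real R := (map_mx (intr : int -> R)).

Definition mx_norm_oo m n (W : 'M[int]_(m, n)) : nat :=
  \max_(i < m) \max_(j < n) `|W i j|%N.

Definition vec_norm1 n (v : 'cV[int]_n) : nat := (\sum_(i < n) `|v i ord0|)%N.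

Section Polytopes.
Variables (R : realType) (n : nat).
Implicit Types (A P F : set 'cV[R]_n) (v : 'cV[int]_n).

Definition convex_hull A : set 'cV[R]_n :=
  smallest (@convex_set R 'cV[R]_n) A.

(* Faces are the sets of maximizers of linear functionals; P itself is the
   face given by h = 0. *)
Definition is_face P F := exists h : 'rV[R]_n,
  F = [set x | P x /\ forall y, P y -> (h *m y) 0 0 <= (h *m x) 0 0].

Definition vertices P : set 'cV[R]_n := [set x | is_face P [set x]].

(* The last condition says that the affine hull of F is a line. *)
Definition is_edge P F := is_face P F /\
  exists x y, [/\ F x, F y, x != y &
    forall z, F z -> exists c : R, z - x = c *: (y - x)].

Definition parallel F v := v != 0 /\
  forall x y, F x -> F y -> exists c : R, y - x = c *: to_real R v.

Definition edge_bound P (k : nat) := forall F, is_edge P F ->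
  exists v, (vec_norm1 v <= k)%N /\ parallel F v.

(* The default value 0 is irrelevant for rational polytopes, which always have
   a bound. *)
Definition edge_complexity P : nat :=
  xget 0%N [set k | edge_bound P k /\
                    forall m, edge_bound P m -> (k <= m)%N].

Definition set_edge_complexity (S : set 'cV[int]_n) : nat :=
  edge_complexity (convex_hull (to_real R @` S)).

End Polytopes.

Definition image_polytope (R : realType) d n (W : 'M[int]_(d, n))
    (S : set 'cV[int]_n) : set 'cV[R]_d :=
  convex_hull [set to_real R (W *m x) | x in S].
Arguments image_polytope R {d n} W S : rename.

Definition linear_optimization_oracle n (S : set 'cV[int]_n)
    (lin : 'rV[int]_n -> 'cV[int]_n) :=
  forall w, S (lin w) /\
    forall x, S x -> (w *m x) 0 0 <= (w *m lin w) 0 0.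

Definition comparison_oracle (R : realType) d (f : 'cV[R]_d -> R)
    (cmp : 'cV[R]_d -> 'cV[R]_d -> bool) :=
  forall y z, cmp y z = (f y < f z).

(* Machine model: a structured random access machine whose memory consists of
   integer arrays. Array names are fixed in the program, cells are addressed
   indirectly, and an address e stands for the natural number `|e|.
   A simple command or a test costs one step; as the expressions
   occurring in a program have constant size, this counts operations on
   integers up to a constant factor. There is no multiplication: a step
   lengthens the numbers in memory by O(1) bits beyond those of the input and of
   the oracle answers, so that unit cost is polynomially equivalent to bit
   cost. An oracle call also pays for the vectors that it transmits. *)
Inductive expr : Type :=
  | Const of int
  | Cell of nat & expr
  | Plus of expr & expr
  | Minus of expr & expr.

(* If and While test whether the value of the expression is positive.
   [LinOracle a b] passes to the linear-optimization oracle the vector stored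
   in array a and writes its answer to array b; [CmpOracle y z a k] writes to
   cell k of array a whether f is smaller at the vector in array y than at the
   vector in array z. *)
Inductive prog : Type :=
  | Skip
  | Store of nat & expr & expr
  | Seq of prog & prog
  | If of expr & prog & prog
  | While of expr & prog
  | LinOracle of nat & nat
  | CmpOracle of nat & nat & nat & expr.

Definition memory := nat -> nat -> int.

Fixpoint eval (s : memory) (e : expr) : int :=
  match e with
  | Const z => z
  | Cell a i => s a `|eval s i|%N
  | Plus e1 e2 => eval s e1 + eval s e2
  | Minus e1 e2 => eval s e1 - eval s e2
  end.

Definition write (s : memory) (a k : nat) (z : int) : memory :=
  fun b j => if (b == a) && (j == k) then z else s b j.

Definition read_vec (m : nat) (s : memory) (a : nat) : 'cV[int]_m :=
  \col_(i < m) s a i.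

Definition write_vec (s : memory) (a : nat) m (v : 'cV[int]_m) : memory :=
  fun b j => if b == a then
               if insub j is Some i then v i ord0 else s b j
             else s b j.

Section Execution.
Variables (R : realType) (d n : nat).
Variable lin : 'rV[int]_n -> 'cV[int]_n.
Variable cmp : 'cV[R]_d -> 'cV[R]_d -> bool.

(* [exec p t s s']: started in memory s, p halts in memory s' after t steps. *)
Inductive exec : prog -> nat -> memory -> memory -> Prop :=
  | ExecSkip s : exec Skip 1 s s
  | ExecStore s a i e :
      exec (Store a i e) 1 s (write s a `|eval s i|%N (eval s e))
  | ExecSeq p q t u s s' s'' :
      exec p t s s' -> exec q u s' s'' -> exec (Seq p q) (t + u)%N s s''
  | ExecIfTrue e p q t s s' :
      0 < eval s e -> exec p t s s' -> exec (If e p q) t.+1 s s'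
  | ExecIfFalse e p q t s s' :
      eval s e <= 0 -> exec q t s s' -> exec (If e p q) t.+1 s s'
  | ExecWhileTrue e p t u s s' s'' :
      0 < eval s e -> exec p t s s' -> exec (While e p) u s' s'' ->
      exec (While e p) (t + u).+1 s s''
  | ExecWhileFalse e p s : eval s e <= 0 -> exec (While e p) 1 s s
  | ExecLinOracle s a b :
      exec (LinOracle a b) n.+1 s (write_vec s b (lin (read_vec n s a)^T))
  | ExecCmpOracle s y z a k :
      exec (CmpOracle y z a k) d.+1 s
        (write s a `|eval s k|%N
           (cmp (to_real R (read_vec d s y)) (to_real R (read_vec d s z)))%:Z).

End Execution.

(* Array 0 starts with n and e, and array 1 holds W column by column. *)
Definition input d n (W : 'M[int]_(d, n)) (e : nat) : memory :=
  fun a k => match a with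
  | 0%N => nth 0 [:: n%:Z; e%:Z] k
  | 1%N => if (insub (k %% d)%N, insub (k %/ d)%N) is (Some i, Some j)
           then W i j else 0
  | _ => 0
  end.

(* Cell 0 of array 0 is the length of the list, and array 1 stores the vectors
   one after the other. *)
Definition output_list (d : nat) (s : memory) : seq 'cV[int]_d :=
  [seq \col_(i < d) s 1%N (k * d + i)%N | k <- iota 0 `|s 0%N 0%N|].

Definition output_vec (n : nat) (s : memory) : 'cV[int]_n := read_vec n s 1.

(* Stands for the absence of a comparison oracle: every answer is negative. *)
Definition no_comparison (R : realType) d (y z : 'cV[R]_d) : bool := false.

(* Main.v *)
(* Every edge direction of conv(WS) is W v for an edge direction v of conv(S), so
   it lies in the box of integer vectors of sup norm at most k = e(S) |W|.  By
   the parametric simplex method, whether a functional is uniquely maximized at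
   a vertex depends only on its signs on that box.  A basic solution of the
   system h g >= 1, for g in the box with positive value, yields by Cramer's
   rule an integer functional with the same signs and entries at most
   d! k^(d-1).  Hence there are O(k^(d(d-1))) vertices, and the algorithm just
   enumerates a grid of such functionals, perturbed by powers of L > 2k so as to
   vanish nowhere on the box: each of them returns a vertex, and all vertices
   are returned.  A convex function attains its maximum over conv(WS) at one of
   them, by Gordan's alternative applied to the points of smaller value. *)

Require Import Defs.
From mathcomp Require Import all_boot all_order all_algebra.
From mathcomp Require Import all_classical all_reals all_analysis.
From mathcomp Require Import perm zify ring lra.

Set Implicit Arguments.
Unset Strict Implicit.
Unset Printing Implicit Defensive.

Import Order.TTheory GRing.Theory Num.Theory.
Local Open Scope classical_set_scope.
Local Open Scope card_scope.
Local Open Scope ring_scope.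

(** * Linear functionals *)

(** The oracle returns a single maximizer, with no hint whether its image under [W] is a vertex. A
    queried functional that is constant on some edge of the image could therefore produce a point
    that is not a vertex. So each queried functional, and not only those from basic solutions, has
    to be nonzero on all nonzero vectors of the box. The low-order part [1, L, ..., L^(d-1)]
    achieves this: on the box it is a number written in base [L] with digits of absolute value below
    [L/2], which is zero only if all digits are.

    Two properties of sign patterns on the box carry the proof. A functional that is positive
    wherever [h0] is keeps the unique maximizer of [h0] ([unique_max_cone]), which gives
    completeness of the grid. A functional without zeros on the box has a maximizer whose image is
    unique ([generic_unique_max]), which gives soundness.

    On the machine a product is a repeated addition, so the repeating factor must be polynomially
    small. Only entries of [W] and one number [Y], found by additions, are used as such factors;
    oracle answers, whose size is not controlled, are only added. *)

Section Functionals.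
Variables (R : realType) (m : nat).
Implicit Types (h q : 'rV[R]_m) (p t : 'cV[R]_m).

Definition ev h p : R := (h *m p) 0 0.

Lemma evDl h q p : ev (h + q) p = ev h p + ev q p.
Proof. by rewrite /ev mulmxDl mxE. Qed.
Lemma evZl a h p : ev (a *: h) p = a * ev h p.
Proof. by rewrite /ev -scalemxAl mxE. Qed.
Lemma evDr h p t : ev h (p + t) = ev h p + ev h t.
Proof. by rewrite /ev mulmxDr mxE. Qed.
Lemma evZr h a p : ev h (a *: p) = a * ev h p.
Proof. by rewrite /ev -scalemxAr mxE. Qed.
Lemma evNr h p : ev h (- p) = - ev h p.
Proof. by rewrite -scaleN1r evZr mulN1r. Qed.
Lemma evBr h p t : ev h (p - t) = ev h p - ev h t.
Proof. by rewrite evDr evNr. Qed.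
Lemma ev0r h : ev h 0 = 0.
Proof. by rewrite -(scale0r 0) evZr mul0r. Qed.

Lemma ev_tr_gt0 p : p != 0 -> 0 < ev p^T p.
Proof.
move=> p0; rewrite /ev mxE lt_def; apply/andP; split; last first.
  by apply: sumr_ge0 => i _; rewrite mxE -expr2 sqr_ge0.
apply: contra p0 => /eqP/psumr_eq0P H; apply/eqP/matrixP => i j.
rewrite ord1 mxE; apply/eqP; have := H _ i isT.
rewrite mxE => /(_ _)/eqP; rewrite mulf_eq0 orbb; apply => k _.
by rewrite mxE -expr2 sqr_ge0.
Qed.

(** Finitely many strict inequalities leave a common margin. All smaller [del] are covered so that
    the thresholds of several vectors can be combined by a minimum. *)
Lemma perturb_pos h q (N : seq 'cV[R]_m) :
  exists2 eps : R, 0 < eps & forall p, p \in N -> 0 < ev h p ->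
    forall del, 0 < del <= eps -> 0 < ev (h + del *: q) p.
Proof.
elim: N => [|p N [e e0 IH]]; first by exists 1.
have [hp|hp] := leP (ev h p) 0.
  exists e => // p'; rewrite inE => /orP[/eqP -> hp'|/IH //].
  by rewrite ltNge hp in hp'.
have q0 : 0 < `|ev q p| + 1 by rewrite ltr_wpDl.
(* The summand [1] keeps the denominator positive when [q] vanishes at [p]. *)
exists (Num.min e (ev h p / (`|ev q p| + 1) / 2)).
  by rewrite lt_min e0 /= !divr_gt0.
move=> p'; rewrite inE => /orP[/eqP -> _ del /andP[d0 dl]|pN hp' del /andP[d0 dl]].
  have {dl} : del <= ev h p / (`|ev q p| + 1) / 2.
    by apply: le_trans dl _; rewrite ge_min lexx orbT.
  rewrite -mulrA -invfM ler_pdivlMr ?mulr_gt0// evDl evZl => dl.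
  have := ler_norm (- ev q p); rewrite normrN => nq.
  have : del * - ev q p <= del * `|ev q p| by rewrite ler_wpM2l // ltW.
  nra.
apply: IH => //; rewrite d0 /=; apply: le_trans dl _.
by rewrite ge_min lexx.
Qed.

(** The vectors of [M] are repaired one at a time: where the functional vanishes at [p], a small
    multiple of [p^T] is added, and [ev p^T p] is a sum of squares. Listing the earlier vectors with
    both signs keeps their nonzero values nonzero. *)
Lemma perturb_generic h (N M : seq 'cV[R]_m) :
  exists h', (forall p, p \in N -> 0 < ev h p -> 0 < ev h' p) /\
             (forall p, p \in M -> p != 0 -> ev h' p != 0).
Proof.
elim: M => [|p M [h' [H1 H2]]]; first by exists h; split.
have [hp|hp] := boolP ((p == 0) || (ev h' p != 0)).
  exists h'; split=> // p'; rewrite inE => /orP[/eqP ->|/H2 //].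
  by move=> p0; rewrite (negbTE p0) in hp.
move: hp; rewrite negb_or negbK => /andP[p0 /eqP hp].
have [e e0 He] := perturb_pos h' p^T (N ++ M ++ map -%R M).
have ee : 0 < e <= e by rewrite e0 lexx.
exists (h' + e *: p^T); split=> [p' pN hp'|p'].
  by apply: He; rewrite ?mem_cat ?pN // H1.
rewrite inE => /orP[/eqP -> _|pM p'0].
  by rewrite evDl hp add0r evZl mulf_neq0 ?gt_eqF// ev_tr_gt0.
have := H2 _ pM p'0; rewrite neq_lt => /orP[lt0|gt0].
  rewrite lt_eqF // -oppr_gt0 -evNr; apply: He => //; last by rewrite evNr oppr_gt0.
  by rewrite !mem_cat map_f ?orbT.
by rewrite gt_eqF //; apply: He => //; rewrite !mem_cat pM orbT.
Qed.

(* Eliminating t: the other vectors are replaced by their projections along t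
   to the kernel of a functional that is positive on them. *)
Lemma gordan (K : set 'cV[R]_m) (T : seq 'cV[R]_m) :
  (forall p t, K p -> K t -> K (p + t)) ->
  (forall a p, 0 < a -> K p -> K (a *: p)) ->
  ~ K 0 -> (forall t, t \in T -> K t) ->
  exists h, forall t, t \in T -> 0 < ev h t.
Proof.
move=> KD KZ K0; move: {2}(size T) (erefl (size T)) => k.
elim: k T => [|k IH] [|t T] //=; first by exists 0.
move=> [sT] KT.
have Kt : K t by apply: KT; rewrite mem_head.
have KT' p : p \in T -> K p by move=> pT; apply: KT; rewrite inE pT orbT.
have t0 : t != 0 by apply/eqP => t0; rewrite t0 in Kt.
have [h Hh] := IH T sT KT'.
have [ht|] := ltP 0 (ev h t).
  by exists h => p; rewrite inE => /orP[/eqP -> //|/Hh].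
rewrite le_eqVlt => /orP[/eqP ht|ht].
  have [e e0 He] := perturb_pos h t^T T.
  have ee : 0 < e <= e by rewrite e0 lexx.
  exists (h + e *: t^T) => p; rewrite inE => /orP[/eqP ->|pT].
    by rewrite evDl ht add0r evZl mulr_gt0 // ev_tr_gt0.
  by apply: He => //; exact: Hh.
(* Since [h] is positive at [p] and negative at [t], [pr p] is [p] plus a positive multiple of [t],
   so it stays in [K]. *)
pose pr p := p - (ev h p / ev h t) *: t.
have pos p : p \in T -> 0 < - (ev h p / ev h t).
  by move=> /Hh hp; rewrite oppr_gt0 pmulr_rlt0 // invr_lt0.
have [|p' /mapP[p pT ->]|h' Hh'] := IH [seq pr p | p <- T].
- by rewrite size_map.
- by rewrite /pr -scaleNr; apply: KD; [exact: KT'|apply: KZ => //; exact: pos].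
pose bad p := ev h p / ev h t.
(* [e1] will be the value of the final functional at [t]; as [bad p] is negative, it must be small
   enough not to destroy positivity at the other vectors. *)
have [e1 e10 He1] : exists2 e1 : R, 0 < e1 &
    forall p, p \in T -> 0 < ev h' (pr p) + e1 * bad p.
  clear -pos Hh'; elim: T pos Hh' => [|p T IHT] pos Hh'; first by exists 1.
  have [||e1 e10 He1] := IHT.
  - by move=> p' pT; apply: pos; rewrite inE pT orbT.
  - by move=> p' pT; apply: Hh'; rewrite /= inE pT orbT.
  have b0 : 0 < - bad p by apply: pos; rewrite mem_head.
  have h0 : 0 < ev h' (pr p) by apply: Hh'; rewrite /= mem_head.
  exists (Num.min e1 (ev h' (pr p) / - bad p / 2)).
    by rewrite lt_min e10 /= !divr_gt0.
  move=> p'; rewrite inE => /orP[/eqP -> |pT].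
    have : Num.min e1 (ev h' (pr p) / - bad p / 2) <= ev h' (pr p) / - bad p / 2.
      by rewrite ge_min lexx orbT.
    rewrite -[X in _ <= X]mulrA -invfM ler_pdivlMr ?mulr_gt0//; nra.
  have := He1 _ pT.
  have : Num.min e1 (ev h' (pr p) / - bad p / 2) <= e1 by rewrite ge_min lexx.
  have : 0 < - bad p' by apply: pos; rewrite inE pT orbT.
  nra.
(* This coefficient gives the value [e1] at [t] and [ev h' (pr p) + e1 * bad p] at [p]. *)
exists (h' + ((e1 - ev h' t) / ev h t) *: h) => p; rewrite inE => /orP[/eqP ->|pT].
  by rewrite evDl evZl divfK ?lt_eqF// addrC subrK.
have := He1 _ pT; rewrite /pr evBr evZr evDl evZl /bad.
set A := ev h' p; set B := ev h' t; set C := ev h p; set D := ev h t.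
suff -> : A - C / D * B + e1 * (C / D) = A + (e1 - B) / D * C by [].
by ring.
Qed.

End Functionals.

(** * Convex hulls and edges *)

Section Hulls.
Variables (R : realType) (m : nat).
Implicit Types (h : 'rV[R]_m) (A Q : set 'cV[R]_m).

Lemma sub_convex_hull A p : A p -> convex_hull A p.
Proof. by move=> Ap Q [_]; apply. Qed.

(** The weights 0 and 1 are settled here once, so that later arguments meet only strictly positive
    weights. *)
Lemma convex_hull_min A Q : A `<=` Q ->
  (forall p q (a b : R), Q p -> Q q -> 0 < a -> 0 < b -> a + b = 1 ->
     Q (a *: p + b *: q)) ->
  convex_hull A `<=` Q.
Proof.
move=> AQ Qc p; apply; split=> // x y l /set_mem Qx /set_mem Qy.
apply/mem_set; have [l0|l0] := eqVneq l%:num 0.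
  rewrite (_ : l = 0%:i01) ?convex.conv0 //; exact: val_inj.
have [l1|l1] := eqVneq l%:num 1.
  rewrite (_ : l = 1%:i01) ?convex.conv1 //; exact: val_inj.
apply: Qc => //.
- by rewrite lt_neqAle eq_sym l0 ge0.
- by rewrite subr_gt0 lt_neqAle l1 le1.
- by rewrite addrC subrK.
Qed.

Lemma convex_hull_le A h (c : R) : (forall p, A p -> ev h p <= c) ->
  forall p, convex_hull A p -> ev h p <= c.
Proof.
move=> Ac; apply: convex_hull_min => // p q a b; rewrite /= evDr !evZr.
move=> pc qc a0 b0 ab; rewrite -[leRHS]mul1r -ab mulrDl.
by apply: lerD; rewrite ler_pM2l.
Qed.

(** A combination with positive weights reaches the maximum only if both of its points do; hence the
    bound and the line condition are carried through the hull together. With [y = 0] the lemma says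
    that the maximizer is unique. *)
Lemma convex_hull_max_line A h (c : R) (x y : 'cV[R]_m) :
  (forall p, A p -> ev h p <= c) ->
  (forall p, A p -> ev h p = c -> exists a : R, p - x = a *: y) ->
  forall p, convex_hull A p -> ev h p = c -> exists a : R, p - x = a *: y.
Proof.
move=> Ac Al p Ap pc.
have : [set p | ev h p <= c /\ (ev h p = c -> exists a : R, p - x = a *: y)] p.
  apply: convex_hull_min Ap => [q Aq|]; first by split; [exact: Ac|exact: Al].
  move=> q q' a b [qc ql] [q'c q'l] a0 b0 ab.
  rewrite /= evDr !evZr.
  have qc' : a * ev h q <= a * c by rewrite ler_pM2l.
  have q'c' : b * ev h q' <= b * c by rewrite ler_pM2l.
  have cE : c = a * c + b * c by rewrite -mulrDl ab mul1r.
  split; first by rewrite [leRHS]cE lerD.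
  move=> E; have /ql [u qu] : ev h q = c.
    apply: (mulfI (lt0r_neq0 a0)); lra.
  have /q'l [v qv] : ev h q' = c.
    apply: (mulfI (lt0r_neq0 b0)); lra.
  exists (a * u + b * v); rewrite scalerDl -!scalerA -qu -qv !scalerBr.
  by rewrite addrACA -opprD -scalerDl ab scale1r.
by move=> [_]; apply.
Qed.

End Hulls.

Lemma seq_argmax (R : realType) (T : eqType) (F : T -> R) (s : seq T) :
  s != [::] -> exists2 x, x \in s & forall y, y \in s -> F y <= F x.
Proof.
elim: s => // x s IH _; have [->|/IH [y ys yM]] := eqVneq s [::].
  by exists x => [|y]; rewrite ?inE// => /eqP ->.
have [xy|yx] := leP (F x) (F y).
  by exists y => [|z]; rewrite inE ?ys ?orbT// => /orP[/eqP ->|/yM].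
exists x => [|z]; rewrite inE ?eqxx// => /orP[/eqP ->//|/yM zy].
exact: le_trans zy (ltW yx).
Qed.

Section RealOf.
Variable R : realType.

Lemma to_realB m n (A B : 'M[int]_(m, n)) :
  to_real R (A - B) = to_real R A - to_real R B.
Proof. exact: map_mxB. Qed.

Lemma to_realM m n p (A : 'M[int]_(m, n)) (B : 'M[int]_(n, p)) :
  to_real R (A *m B) = to_real R A *m to_real R B.
Proof. exact: map_mxM. Qed.

Lemma to_real_inj m n : injective (to_real R : 'M[int]_(m, n) -> 'M[R]_(m, n)).
Proof.
move=> A B /matrixP E; apply/matrixP => i j.
by have := E i j; rewrite !mxE => /intr_inj.
Qed.

Lemma to_real_eq0 m n (A : 'M[int]_(m, n)) : (to_real R A == 0) = (A == 0).
Proof.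
apply/eqP/eqP => [E|->]; last exact: map_mx0.
by apply: to_real_inj; rewrite E; apply/esym/map_mx0.
Qed.

Lemma ev_to_real n (w : 'rV[int]_n) x : ev (to_real R w) (to_real R x) = ((w *m x) 0 0)%:~R.
Proof. by rewrite /ev -to_realM mxE. Qed.

Lemma ev_mul d n (h : 'rV[R]_d) (W : 'M[int]_(d, n)) x :
  ev (h *m to_real R W) (to_real R x) = ev h (to_real R (W *m x)).
Proof. by rewrite /ev to_realM mulmxA. Qed.

End RealOf.

Section Edges.
Variables (R : realType) (n : nat) (s : seq 'cV[int]_n).
Local Notation r := (to_real R).
Local Notation P := (convex_hull (to_real R @` [set` s])).

(** Collinearity of the maximizers in [s] passes to the whole face of the hull, which is therefore
    an edge; it contains [x] and [y], so their difference inherits its short integer direction. *)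
Lemma tie_line_edge (c : 'rV[R]_n) x y k : edge_bound P k ->
  x \in s -> y \in s -> x != y -> ev c (r x) = ev c (r y) ->
  (forall z, z \in s -> ev c (r z) <= ev c (r x)) ->
  (forall z, z \in s -> ev c (r z) = ev c (r x) ->
     exists a : R, r z - r x = a *: (r y - r x)) ->
  exists v (a : R), [/\ (vec_norm1 v <= k)%N, v != 0 & r y - r x = a *: r v].
Proof.
move=> Pk xs ys xy cxy cmax cline.
pose F := [set z | P z /\ forall y, P y -> (c *m y) 0 0 <= (c *m z) 0 0].
have Pmax z : P z -> ev c z <= ev c (r x).
  by apply: convex_hull_le => p [w ws <-]; exact: cmax.
have Px z : z \in s -> P (r z) by move=> zs; apply: sub_convex_hull; exists z.
have Fx : F (r x) by split; [exact: Px|exact: Pmax].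
have Fy : F (r y).
  by split=> [|z /Pmax]; [exact: Px|rewrite cxy].
have FE : is_edge P F.
  split; first by exists c.
  exists (r x), (r y); split=> //.
    by rewrite (inj_eq (@to_real_inj _ _ _)).
  move=> z [Pz zmax].
  apply: (convex_hull_max_line _ _ Pz).
  - by move=> p [w ws <-]; exact: cmax.
  - by move=> p [w ws <-]; exact: cline.
  - by apply/eqP; rewrite eq_le Pmax //=; exact: zmax (Px _ xs).
have [v [vk [v0 vF]]] := Pk _ FE.
by have [a av] := vF _ _ Fx Fy; exists v, a.
Qed.

(* The parametric simplex method: a generic perturbation of a is tilted towards
   b until the first tie, which spans an edge. *)
Lemma improving_edge (a b : 'rV[R]_n) x y k : edge_bound P k ->
  x \in s -> (forall z, z \in s -> ev a (r z) <= ev a (r x)) ->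
  (forall z, z \in s -> ev a (r z) = ev a (r x) -> ev b (r z) = ev b (r x)) ->
  y \in s -> ev b (r x) < ev b (r y) ->
  exists v, [/\ (vec_norm1 v <= k)%N, 0 < ev a (r v) & ev b (r v) < 0].
Proof.
move=> Pk xs xmax xb ys bxy.
pose D := [seq r z - r w | z <- s, w <- s].
(* Two differences on which [a' + tau b] vanishes give a vector of this list on which [a'] vanishes.
   Genericity of [a'] makes that vector zero, so the two differences are proportional. *)
pose D2 := [seq ev b q *: p - ev b p *: q | p <- D, q <- D].
have [a' [a'pos a'neq]] := perturb_generic a D (D ++ D2).
have DP z w : z \in s -> w \in s -> r z - r w \in D.
  by move=> zs ws; apply: allpairs_f.
have [x0 x0s x0max] : exists2 x, x \in s & forall y, y \in s -> ev a' (r y) <= ev a' (r x).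
  by apply: (seq_argmax (fun x => ev a' (r x))); case: (s) xs.
have ax0 : ev a (r x0) = ev a (r x).
  apply/eqP; rewrite eq_le xmax //= leNgt; apply/negP => lt.
  have := a'pos _ (DP _ _ xs x0s); rewrite !evBr !subr_gt0 => /(_ lt).
  by rewrite ltNge x0max.
have bx0 := xb _ x0s ax0.
pose T := [seq z <- s | ev b (r x0) < ev b (r z)].
(* The parameter at which [z] catches up with [x0] in [a' + tau b]; its minimum over [T] is the
   first tie. *)
pose tau z := (ev a' (r x0) - ev a' (r z)) / (ev b (r z) - ev b (r x0)).
have [z0] : exists2 z, z \in T & forall w, w \in T -> - tau w <= - tau z.
  apply: (seq_argmax (fun z => - tau z)); apply/eqP => T0.
  have : y \in T by rewrite mem_filter bx0 bxy ys.
  by rewrite T0.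
rewrite mem_filter => /andP[bz0 z0s] z0min.
pose c := a' + tau z0 *: b.
have tau0 : 0 <= tau z0.
  by rewrite divr_ge0 // subr_ge0 ?x0max // ltW.
have cmax z : z \in s -> ev c (r z) <= ev c (r x0).
  move=> zs; rewrite !evDl !evZl; have [bz|bz] := ltP (ev b (r x0)) (ev b (r z)).
    have : z \in T by rewrite mem_filter bz.
    move=> /z0min; rewrite lerN2 [X in _ <= X]/tau ler_pdivlMr ?subr_gt0 //.
    by rewrite mulrBr; lra.
  by apply: lerD; [exact: x0max|rewrite ler_wpM2l].
have cz0 : ev c (r x0) = ev c (r z0).
  rewrite !evDl !evZl; have : tau z0 * (ev b (r z0) - ev b (r x0)) = ev a' (r x0) - ev a' (r z0).
    by rewrite /tau divfK // gt_eqF // subr_gt0.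
  by rewrite mulrBr; lra.
have x0z0 : x0 != z0 by apply: contraTneq bz0 => ->; rewrite ltxx.
have bq : 0 < ev b (r z0 - r x0) by rewrite evBr subr_gt0.
have cline z : z \in s -> ev c (r z) = ev c (r x0) ->
    exists u : R, r z - r x0 = u *: (r z0 - r x0).
  move=> zs cz; set p := r z - r x0; set q := r z0 - r x0.
  have pq0 : ev b q *: p - ev b p *: q = 0.
    apply/eqP; have H: ev b q *: p - ev b p *: q \in D ++ D2.
      by rewrite mem_cat; apply/orP; right; apply: allpairs_f; exact: DP.
    apply: contraT => /(a'neq _ H) {H}.
    have cp : ev c p = 0 by rewrite evBr cz subrr.
    have cq : ev c q = 0 by rewrite evBr cz0 subrr.
    rewrite !evDl !evZl in cp cq; rewrite {}/p {}/q in cp cq *.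
    move: (r z - _) (r z0 - _) bq cp cq => p q bq cp cq.
    rewrite evBr !evZr.
    suff -> : ev b q * ev a' p - ev b p * ev a' q = 0 by rewrite eqxx.
    have -> : ev a' p = - (tau z0 * ev b p) by lra.
    have -> : ev a' q = - (tau z0 * ev b q) by lra.
    by ring.
  exists (ev b p / ev b q).
  have bq0 : ev b q != 0 by rewrite gt_eqF.
  move/eqP: pq0; rewrite subr_eq0 => /eqP pq0.
  by rewrite mulrC -scalerA -pq0 scalerA mulVf // scale1r.
have [v [u [vk v0 qv]]] := tie_line_edge Pk x0s z0s x0z0 cz0 cmax cline.
(* Maximizers of [a] all have the same value of [b], and [z0] has a larger one. The edge direction
   is then oriented from [z0] towards [x0], which gives the claimed signs. *)
have aq : ev a (r z0 - r x0) < 0.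
  rewrite lt_neqAle evBr subr_le0 subr_eq0 ax0 xmax // andbT.
  by apply: contraTneq bz0 => /xb -> //; rewrite bx0 ltxx.
rewrite qv !evZr in aq bq.
have u0 : u != 0 by apply: contraTneq bq => ->; rewrite mul0r ltxx.
move: u0; rewrite neq_lt => /orP[u0|u0].
  rewrite nmulr_rlt0 // in aq; rewrite nmulr_rgt0 // in bq.
  by exists v.
rewrite pmulr_rlt0 // in aq; rewrite pmulr_rgt0 // in bq.
exists (- v); rewrite (_ : r (- v) = - r v) ?map_mxN // !evNr oppr_gt0 oppr_lt0.
split=> //; rewrite /vec_norm1 (eq_bigr (fun i => `|v i ord0|%N)) // => i _.
by rewrite mxE abszN.
Qed.

End Edges.

(** * Unique maximizers *)

Section EdgeComplexity.
Variables (R : realType) (n : nat) (s : seq 'cV[int]_n).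
Local Notation r := (to_real R).
Local Notation P := (convex_hull (to_real R @` [set` s])).

(** An edge contains two distinct points of [s], for otherwise [convex_hull_max_line] would shrink
    it to one point. Their difference is an integer direction, so the largest 1-norm of a difference
    serves as a bound. *)
Lemma edge_has_bound : exists k, edge_bound P k.
Proof.
exists (\max_(z <- s) \max_(w <- s) vec_norm1 (z - w))%N.
move=> F [[c FE] [p [q [Fp Fq pq Fl]]]].
have sPs z : z \in s -> P (r z) by move=> zs; apply: sub_convex_hull; exists z.
have s0 : s != [::].
  apply/eqP => s0; move: Fp; rewrite FE => -[Pp _]; move: p Pp {Fl pq} => p.
  by apply: (@convex_hull_min _ _ _ set0) => // y [x]; rewrite /= s0.
have [x xs xmax] := seq_argmax (fun x => ev c (r x)) s0.
have Pmax z : P z -> ev c z <= ev c (r x).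
  by apply: convex_hull_le => t [w ws <-]; exact: xmax.
have FP z : F z <-> P z /\ ev c z = ev c (r x).
  rewrite FE; split=> [[Pz zM]|[Pz zE]]; split=> //.
    by apply/eqP; rewrite eq_le Pmax //=; apply: (zM (r x)); exact: sPs.
  by move=> y /Pmax; rewrite -zE.
have [[y ys [yx cy]]|none] := pselect (exists2 y, y \in s & y != x /\ ev c (r y) = ev c (r x)).
  exists (y - x); split.
    apply: leq_trans (leq_bigmax_seq _ ys isT).
    exact: (@leq_bigmax_seq _ _ _ (fun w => vec_norm1 (y - w)) _ xs isT).
  split; first by rewrite subr_eq0.
  have /Fl [a xa] : F (r x) by apply/FP; split => //; exact: sPs.
  have /Fl [b yb] : F (r y) by apply/FP; split => //; exact: sPs.
  have yxE : r (y - x) = (b - a) *: (q - p).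
    by rewrite to_realB scalerBl -xa -yb opprB addrA subrK.
  have ba : b - a != 0.
    apply: contra yx => /eqP ba; rewrite ba scale0r in yxE.
    by rewrite -subr_eq0 -(to_real_eq0 R) yxE.
  move=> z w /Fl [u zu] /Fl [v wv]; exists ((v - u) / (b - a)).
  rewrite yxE scalerA divfK // scalerBl -zu -wv opprB addrA subrK //.
have Fx z : F z -> z = r x.
  move=> /FP [Pz cz]; have [||a] := @convex_hull_max_line _ _ _ c (ev c (r x)) (r x) 0 _ _ _ Pz cz.
  - by move=> t [w ws <-]; exact: xmax.
  - move=> t [w ws <-] cw; exists 0; have [->|wx] := eqVneq w x; first by rewrite subrr scaler0.
    by exfalso; apply: none; exists w.
  by rewrite scaler0 => /eqP; rewrite subr_eq0 => /eqP.
by move: pq; rewrite (Fx _ Fp) (Fx _ Fq) eqxx.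
Qed.

(** Some bound exists, so a least one does, and [xget] returns it instead of its default 0. *)
Lemma edge_complexityP k :
  (edge_complexity P <= k)%N -> edge_bound P k.
Proof.
have [k0 k0P] := edge_has_bound.
have ex : exists k, `[<edge_bound P k>] by exists k0; apply/asboolP.
have [m /asboolP mP mmin] := ex_minnP ex.
have [] : edge_bound P (edge_complexity P) /\
          forall m, edge_bound P m -> (edge_complexity P <= m)%N.
  rewrite /edge_complexity; set Q := (X in xget _ X); apply: (@xgetPex _ 0%N Q).
  by exists m; split=> // j jP; apply: mmin; apply/asboolP.
move=> H _ le F /H [v [vk vF]]; exists v; split=> //; exact: leq_trans vk le.
Qed.

End EdgeComplexity.

Section Boxes.
Variable d : nat.

Definition in_box (k : nat) (g : 'cV[int]_d) := forall i, (`|g i 0%R| <= k)%N.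

Definition box (k : nat) : seq 'cV[int]_d :=
  [seq \col_i ((f i)%:Z - k%:Z) | f : {ffun 'I_d -> 'I_(2 * k).+1}].

Lemma boxP k g : reflect (in_box k g) (g \in box k).
Proof.
apply: (iffP mapP) => [[f _ -> i]|gk].
  by rewrite mxE; move: (nat_of_ord _) (ltn_ord (f i)) => a; lia.
have H i : (`|(g i 0%R + k%:Z)%R| < (2 * k).+1)%N by have := gk i; lia.
exists [ffun i => Ordinal (H i)]; first by rewrite mem_enum.
apply/colP => i; rewrite !mxE ffunE /=; have := gk i; lia.
Qed.

Lemma size_box k : size (box k) = ((2 * k).+1 ^ d)%N.
Proof. by rewrite size_map -cardE card_ffun !card_ord. Qed.

Lemma in_boxN k g : in_box k g -> in_box k (- g).
Proof. by move=> gk i; rewrite mxE abszN. Qed.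

Lemma mx_norm_ooP n (W : 'M[int]_(d, n)) i j : (`|W i j| <= mx_norm_oo W)%N.
Proof.
apply: leq_trans (leq_bigmax i); exact: (leq_bigmax (F := fun j => `|W i j|%N) j).
Qed.

Lemma in_box_mul n (W : 'M[int]_(d, n)) v e k :
  (vec_norm1 v <= e)%N -> (e * mx_norm_oo W <= k)%N -> in_box k (W *m v).
Proof.
move=> ve ek i; rewrite mxE.
have : (`|(\sum_j W i j * v j 0%R)%R| <= \sum_j `|(W i j * v j 0%R)%R|)%N.
  elim/big_ind2 : _ => // x1 x2 y1 y2 h1 h2.
  by apply: leq_trans (leq_add h1 h2); lia.
move/leq_trans; apply; apply: leq_trans ek.
apply: (@leq_trans (vec_norm1 v * mx_norm_oo W)); last by rewrite leq_mul2r ve orbT.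
rewrite /vec_norm1 big_distrl /=; apply: leq_sum => j _.
by rewrite abszM mulnC leq_mul2l mx_norm_ooP orbT.
Qed.

End Boxes.

Section UniqueMax.
Variables (R : realType) (d n : nat) (s : seq 'cV[int]_n) (W : 'M[int]_(d, n)).
Local Notation r := (to_real R).
Local Notation P := (convex_hull (to_real R @` [set` s])).
Implicit Types (h : 'rV[R]_d).

(* Unique modulo the kernel of W. *)
Definition unique_max h x := x \in s /\
  forall y, y \in s -> W *m y != W *m x -> ev h (r (W *m y)) < ev h (r (W *m x)).

Variables (e k : nat).
Hypotheses (Pe : edge_bound P e) (ek : (e * mx_norm_oo W <= k)%N).

(** If [h] preferred or tied another point, an edge direction [v] would have [W v] positive for [h0]
    but not for [h]; yet [W v] lies in the box, where [h] follows the positive signs of [h0]. *)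
Lemma unique_max_cone h0 h x : unique_max h0 x ->
  (forall g, in_box k g -> 0 < ev h0 (r g) -> 0 < ev h (r g)) ->
  unique_max h x.
Proof.
move=> [xs x0] hk; split=> // y ys yx; rewrite ltNge; apply/negP => xy.
have [del del0 Hd] := perturb_pos h (- h0) [seq r g | g <- box d k].
have dd : 0 < del <= del by rewrite del0 lexx.
(* Subtracting a little of [h0] turns a possible tie between [x] and [y] into a strict gain of [y],
   without losing positive values on the box. *)
pose h1 := h + del *: (- h0).
have h1E p : ev h1 p = ev h p - del * ev h0 p.
  by rewrite /h1 evDl evZl -[- h0]scaleN1r evZl mulN1r mulrN.
have [||| v [ve av bv]] := @improving_edge R n s (h0 *m r W) (h1 *m r W) x y e Pe xs _ _ ys.
- move=> z zs; rewrite !ev_mul; have [->//|zx] := eqVneq (W *m z) (W *m x).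
  exact: ltW (x0 _ zs zx).
- move=> z zs; rewrite !ev_mul; have [->//|zx] := eqVneq (W *m z) (W *m x).
  by have := x0 _ zs zx => /[swap] ->; rewrite ltxx.
- rewrite !ev_mul !h1E; have := x0 _ ys yx.
  by rewrite -(ltr_pM2l del0); lra.
rewrite !ev_mul in av bv.
have vk := in_box_mul ve ek.
have /boxP vb := vk.
have := Hd _ (map_f _ vb) (hk _ vk av) _ dd.
by rewrite -/h1 ltNge (ltW bv).
Qed.

(** A perturbation of [h] that separates all images has a unique maximizer. As [h] has no zeros on
    the box, it has the same signs there as the perturbation, so the cone lemma transfers uniqueness
    back to [h]. *)
Lemma generic_unique_max h x :
  (forall g, in_box k g -> g != 0 -> ev h (r g) != 0) ->
  x \in s -> (forall y, y \in s -> ev h (r (W *m y)) <= ev h (r (W *m x))) ->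
  unique_max h x.
Proof.
move=> hg xs xmax.
pose D := [seq r (W *m z - W *m w) | z <- s, w <- s].
have [h0 [h0pos h0neq]] := perturb_generic h [seq r g | g <- box d k] D.
have s0 : s != [::] by apply: contraTneq xs => ->.
have [x1 x1s x1max] := seq_argmax (fun x => ev h0 (r (W *m x))) s0.
have x1U : unique_max h0 x1.
  split=> // y ys yx; rewrite lt_neqAle x1max // andbT -subr_eq0 -evBr -to_realB.
  by apply: h0neq; [exact: allpairs_f|rewrite to_real_eq0 subr_eq0].
have [_ x1h] : unique_max h x1.
  apply: (unique_max_cone x1U) => g gk h0g.
  have g0 : g != 0 by apply: contraTneq h0g => ->; rewrite map_mx0 ev0r ltxx.
  have := hg _ gk g0; rewrite neq_lt => /orP[lt0|//].
  have /boxP Ngb := in_boxN gk.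
  have := h0pos _ (map_f _ Ngb).
  by rewrite (_ : r (- g) = - r g) ?map_mxN // !evNr !oppr_gt0 => /(_ lt0) /(lt_trans h0g); rewrite ltxx.
have xE : W *m x = W *m x1.
  by apply/eqP; apply: contraT => /(x1h _ xs); rewrite ltNge xmax.
by split=> // y ys; rewrite xE; exact: x1h.
Qed.

(** A linear functional on the hull attains its maximum at an image of a point of [s], which leads
    from a vertex to a point [x]. The converse is [convex_hull_max_line] with direction 0. *)
Lemma verticesP u : vertices (image_polytope R W [set` s]) u <->
  exists x h, unique_max h x /\ u = r (W *m x).
Proof.
set Q := image_polytope R W [set` s].
have QW x : x \in s -> Q (r (W *m x)) by move=> xs; apply: sub_convex_hull; exists x.
split=> [[h /seteqP [uP Pu]]|[x [h [[xs xU] ->]]]].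
  have [Qu umax] := uP u erefl.
  have s0 : s != [::].
    apply/eqP => s0; move: u Qu {uP Pu umax} => u.
    by apply: (@convex_hull_min _ _ _ set0) => // y [x]; rewrite /= s0.
  have [x xs xmax] := seq_argmax (fun x => ev h (r (W *m x))) s0.
  have Qmax z : Q z -> ev h z <= ev h (r (W *m x)).
    by apply: convex_hull_le => t [w ws <-]; exact: xmax.
  have uE : u = r (W *m x) by apply/esym/Pu; split=> [|y /Qmax //]; exact: QW.
  exists x, h; split=> //; split=> // y ys yx.
  rewrite lt_neqAle xmax // andbT; apply: contra yx => /eqP yxE; apply/eqP.
  apply: (@to_real_inj R); rewrite -uE; apply: Pu; split; first exact: QW.
  by move=> z /Qmax; rewrite -yxE.
have xmax y : y \in s -> ev h (r (W *m y)) <= ev h (r (W *m x)).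
  by move=> ys; have [->//|/(xU _ ys)/ltW] := eqVneq (W *m y) (W *m x).
have Qmax z : Q z -> ev h z <= ev h (r (W *m x)).
  by apply: convex_hull_le => t [w ws <-]; exact: xmax.
exists h; apply/seteqP; split=> [z ->|z [Qz zmax]].
  by split=> [|y /Qmax //]; exact: QW.
have [|||a] := @convex_hull_max_line _ _ _ h (ev h (r (W *m x))) (r (W *m x)) 0 _ _ _ Qz.
- by move=> t [w ws <-]; exact: xmax.
- move=> t [w ws <-] tE; exists 0; rewrite scaler0; apply/eqP; rewrite subr_eq0.
  apply: contraT => wx; have := xU w ws; rewrite tE ltxx; apply.
  by apply: contra wx => /eqP ->.
- by apply/eqP; rewrite eq_le Qmax //=; apply: (zmax _ (QW _ xs)).
by rewrite scaler0 => /eqP; rewrite subr_eq0 => /eqP.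
Qed.

End UniqueMax.

(** * Basic solutions *)

(** Leibniz formula: [m!] products of [m] entries. *)
Lemma absz_det_le m (A : 'M[int]_m) k : (forall i j, `|A i j| <= k)%N ->
  (`|\det A| <= m`! * k ^ m)%N.
Proof.
move=> Ak; rewrite /determinant.
have /leq_trans : (`|(\sum_(s : 'S_m) (-1) ^+ s * \prod_i A i (s i))%R|
    <= \sum_(s : 'S_m) k ^ m)%N.
  elim/big_ind2 : _ => // [x1 x2 y1 y2 h1 h2|s _].
    by apply: leq_trans (leq_add h1 h2); lia.
  rewrite abszMsign; have -> : (k ^ m = \prod_(i < m) k)%N by rewrite prod_nat_const card_ord.
  elim/big_ind2 : _ => // x1 x2 y1 y2 h1 h2.
  by rewrite abszM leq_mul.
by apply; rewrite sum_nat_const card_Sn.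
Qed.

Section SmallFunctional.
Variables (R : realType) (d k : nat).
Hypothesis k_gt0 : (0 < k)%N.
Local Notation r := (to_real R).

(** Pairing a vanishing combination of the rows with [q] leaves only the coefficient of [a], which
    must then be zero. *)
Lemma row_free_col_mx m (a : 'rV[R]_d) (M : 'M[R]_(m, d)) (q : 'cV[R]_d) :
  row_free M -> M *m q = 0 -> a *m q != 0 -> row_free (col_mx a M).
Proof.
move=> Mf Mq aq; apply: inj_row_free => v; rewrite -[v]hsubmxK mul_row_col => E.
have l0 : lsubmx v = 0.
  have := congr1 (mulmx^~ q) E; rewrite mulmxDl -!mulmxA Mq mulmx0 addr0 mul0mx.
  rewrite [a *m q]mx11_scalar mul_mx_scalar => /eqP; rewrite scaler_eq0.
  case/orP => /eqP // aq0; move: aq; rewrite [a *m q]mx11_scalar aq0.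
  by rewrite (_ : 0%:M = 0) ?eqxx //; apply/matrixP => i j; rewrite !mxE mul0rn.
rewrite l0 mul0mx add0r in E; rewrite l0; suff -> : rsubmx v = 0 by exact: row_mx0.
by apply: (row_free_inj Mf); rewrite mul0mx.
Qed.

(** Tight constraints are collected one by one. While fewer than [d] are tight, some [q] is
    orthogonal to all of them, and [h] moves along [q] until another becomes tight; the new row is
    independent because [q] does not vanish on it. *)
Lemma basic_solution (G : seq 'cV[int]_d) (h1 : 'rV[R]_d) :
  (forall g, g \in G -> 0 < ev h1 (r g)) ->
  (forall q : 'cV[R]_d, q != 0 -> exists2 g, g \in G & ev q^T (r g) != 0) ->
  exists (M : 'M[int]_d) (h : 'rV[R]_d),
    [/\ forall i, (row i M)^T \in G, row_free (r M),
        forall g, g \in G -> 1 <= ev h (r g) & r M *m h^T = const_mx 1].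
Proof.
move=> h1G Gspan.
suff /(_ d (leqnn d)) : forall m, (m <= d)%N ->
  exists (M : 'M[int]_(m, d)) (h : 'rV[R]_d),
    [/\ forall i, (row i M)^T \in G, row_free (r M),
        forall g, g \in G -> 1 <= ev h (r g) & r M *m h^T = const_mx 1] by [].
elim=> [_|m IH md].
  have [c Hc] : exists c : R, forall g, g \in G -> 1 <= c * ev h1 (r g).
    have [G0|G0] := eqVneq G [::]; first by exists 0 => g; rewrite G0.
    have [g0 g0G g0min] := seq_argmax (fun g => - ev h1 (r g)) G0.
    have hg0 := h1G _ g0G.
    exists (ev h1 (r g0))^-1 => g /g0min; rewrite lerN2 mulrC ler_pdivlMr //.
    by rewrite mul1r.
  exists (const_mx 0), (c *: h1); split=> [[]//||g gG|].
  - by rewrite -row_leq_rank leq0n.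
  - by rewrite evZl Hc.
  - by apply/matrixP => -[].
have [M [h [MG Mf hG Mh]]] := IH (ltnW md).
have [q q0 Mq] : exists2 q : 'cV[R]_d, q != 0 & r M *m q = 0.
  have cM0 : cokermx (r M) != 0.
    by rewrite -mxrank_eq0 mxrank_coker (eqP Mf) subn_eq0 -ltnNge.
  have [i [j cMij]] : exists i j, cokermx (r M) i j != 0.
    apply: contrapT => H; case/eqP: cM0; apply/matrixP => i j.
    by rewrite [RHS]mxE; apply: contrapT => /eqP ?; apply: H; exists i, j.
  exists (col j (cokermx (r M))).
    by apply: contra cMij => /eqP/colP/(_ i); rewrite !mxE => ->.
  by rewrite colE mulmxA mulmx_coker mul0mx.
(* By [Gspan], [q] is nonzero on some constraint; up to its sign it decreases there, so the move is
   stopped. *)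
wlog [g0 g0G qg0] : q q0 Mq / exists2 g, g \in G & ev q^T (r g) < 0.
  move=> H; have [g gG] := Gspan q q0.
  rewrite neq_lt => /orP[lt0|gt0]; first by apply: (H q) => //; exists g.
  apply: (H (- q)); rewrite ?oppr_eq0 // ?mulmxN ?Mq ?oppr0 //.
  by exists g => //; rewrite linearN /= -scaleN1r evZl mulN1r oppr_lt0.
pose T := [seq g <- G | ev q^T (r g) < 0].
(* Ratio test: the step length at which constraint [g] becomes tight. *)
pose tau g := (ev h (r g) - 1) / - ev q^T (r g).
have [g1] : exists2 g, g \in T & forall g', g' \in T -> - tau g' <= - tau g.
  apply: (seq_argmax (fun g => - tau g)); apply/eqP => T0.
  have : g0 \in T by rewrite mem_filter qg0.
  by rewrite T0.
rewrite mem_filter => /andP[qg1 g1G] g1min.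
have tau0 : 0 <= tau g1.
  by rewrite divr_ge0 ?subr_ge0 ?hG // oppr_ge0 ltW.
suff : exists (M : 'M[int]_((1 + m)%N, d)) (h : 'rV[R]_d),
    [/\ forall i, (row i M)^T \in G, row_free (r M),
        forall g, g \in G -> 1 <= ev h (r g) & r M *m h^T = const_mx 1] by [].
exists (col_mx g1^T M), (h + tau g1 *: q^T); split.
- move=> i; rewrite -[i]splitK; case: (fintype.split i) => j /=.
    by rewrite rowKu (_ : row j g1^T = g1^T) ?trmxK //; apply/rowP => l; rewrite !mxE !ord1.
  by rewrite rowKd.
- rewrite map_col_mx; apply: (row_free_col_mx (q := q)) => //.
  apply/eqP => E; move: qg1; rewrite /ev -[q^T *m _]trmxK trmx_mul trmxK.
  by rewrite map_trmx E !mxE ltxx.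
- move=> g gG; rewrite evDl evZl; have [qg|qg] := ltP (ev q^T (r g)) 0.
    have : g \in T by rewrite mem_filter qg.
    move=> /g1min; rewrite lerN2 [X in _ <= X]/tau ler_pdivlMr ?oppr_gt0 //.
    by lra.
  by rewrite -[leLHS]addr0 lerD ?hG // mulr_ge0.
- rewrite map_col_mx mul_col_mx linearD linearZ /= trmxK !mulmxDr -!scalemxAr.
  rewrite Mq scaler0 addr0 Mh.
  have : ev h (r g1) + tau g1 * ev q^T (r g1) = 1.
    have : tau g1 * - ev q^T (r g1) = ev h (r g1) - 1.
      by rewrite /tau divfK // oppr_eq0 lt_eqF.
    by lra.
  have E a : r g1^T *m a^T = (ev a (r g1))%:M.
    rewrite [LHS]mx11_scalar; congr (_%:M).
    by rewrite /ev -[a *m _]trmxK trmx_mul [RHS]mxE map_trmx.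
  rewrite -{2}[q]trmxK !E => {}E.
  rewrite -[RHS]vsubmxK; congr col_mx.
    by apply/matrixP => i j; rewrite !mxE !ord1 /= !mulr1n.
  by apply/matrixP => i j; rewrite !mxE.
Qed.

(** Genericity puts [g] or [-g] into [G] for every nonzero box vector [g]. Since [k] is positive,
    this applies to the unit vectors, and [G] spans the space. *)
Lemma small_functional (h0 : 'rV[R]_d) : exists h : 'rV[int]_d,
  (forall i, `|h 0%R i| <= d`! * k ^ d.-1)%N /\
  (forall g, in_box k g -> 0 < ev h0 (r g) -> 0 < ev (r h) (r g)).
Proof.
have [h1 [h1pos h1neq]] := perturb_generic h0 [seq r g | g <- box d k] [seq r g | g <- box d k].
pose G := [seq g <- box d k | 0 < ev h1 (r g)].
have [||M [h [MG Mf hG Mh]]] := @basic_solution G h1.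
- by move=> g; rewrite mem_filter => /andP[].
- move=> q q0; have [i qi] : exists i, q i 0 != 0.
    apply/existsP; move: q0; apply: contraR => /existsPn H.
    by apply/eqP/colP => i; rewrite mxE; apply/eqP; have := H i; rewrite negbK.
  have eE : ev q^T (r (delta_mx i 0)) = q i 0.
    rewrite /ev mxE (bigD1 i) //= !mxE !eqxx mulr1 big1 ?addr0 // => j ji.
    by rewrite !mxE (negbTE ji) mulr0.
  have ek : in_box k (delta_mx i 0) by move=> j; rewrite mxE; case: (_ && _).
  have e0 : r (delta_mx i (0 : 'I_1)) != 0.
    rewrite to_real_eq0; apply/eqP => /matrixP /(_ i 0).
    by rewrite !mxE !eqxx.
  have /boxP eb := ek; have /boxP Neb := in_boxN ek.
  have := h1neq _ (map_f _ eb) e0; rewrite neq_lt => /orP[lt0|gt0].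
    exists (- delta_mx i 0); last by rewrite (_ : r (- _) = - r (delta_mx i 0)) ?map_mxN // evNr oppr_eq0 eE.
    by rewrite mem_filter Neb (_ : r (- _) = - r (delta_mx i 0)) ?map_mxN // evNr oppr_gt0 lt0.
  exists (delta_mx i 0); last by rewrite eE.
  by rewrite mem_filter eb gt0.
have Mu : r M \in unitmx by rewrite -row_free_unit.
have adjE : r (\adj M *m const_mx 1) = (\det M)%:~R *: h^T.
  apply: (can_inj (mulKmx Mu)); rewrite -scalemxAr Mh -to_realM mulmxA mul_mx_adj.
  rewrite mul_scalar_mx; apply/matrixP => i j; rewrite !mxE.
  by rewrite !mulr1.
(* [\adj M] times the all-ones vector is [\det M] times the basic solution; the sign makes the
   multiple positive. *)
exists (sgz (\det M) *: (\adj M *m const_mx 1)^T); split=> [i|g gk h0g].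
  rewrite !mxE abszM; apply: (@leq_trans `|(\sum_j \adj M i j)%R|).
    rewrite -[leqRHS]mul1n; apply: leq_mul; first by case: sgzP.
    by rewrite (eq_bigr (\adj M i)) // => j _; rewrite !mxE ?mulr1.
  (* Each entry is a sum of [d] cofactors bounded by [(d-1)! k^(d-1)], which explains the factor
     [d!]. *)
  have /leq_trans : (`|(\sum_j \adj M i j)%R| <= \sum_(j < d) d.-1`! * k ^ d.-1)%N.
    elim/big_ind2 : _ => // [x1 x2 y1 y2 a1 a2|j _].
      by apply: leq_trans (leq_add a1 a2); lia.
    rewrite mxE /cofactor abszMsign; apply: absz_det_le => u v.
    rewrite !mxE; have := MG (lift j u); rewrite mem_filter => /andP[_ /boxP/(_ (lift i v))].
    by rewrite !mxE.
  apply; rewrite sum_nat_const card_ord mulnA leq_mul2r; apply/orP; right.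
  by case: (d) i => [[]//|d' _]; rewrite factS.
have gG : g \in G.
  have /boxP gb := gk; rewrite mem_filter gb andbT.
  by apply: h1pos => //; exact: map_f.
have -> : r (sgz (\det M) *: (\adj M *m const_mx 1)^T) = `|\det M|%:~R *: h.
  rewrite map_mxZ -map_trmx adjE linearZ /= trmxK scalerA -intrM.
  by congr (_%:~R *: _); case: sgzP => D0; rewrite ?mul1r ?mulN1r ?mul0r ?D0.
rewrite evZl mulr_gt0 // ?(lt_le_trans _ (hG _ gG)) // ltr0z normr_gt0.
apply: contraTneq Mu => D0; rewrite unitmxE det_map_mx D0 rmorph0 unitr0 //.
Qed.

End SmallFunctional.

(** * The grid of functionals *)

Section Grid.

(** Balanced digits: the new term adds at most [2 k L^m] to twice the sum, and [2 k + 1 <= L]. *)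
Lemma radix_sum_lt (m L k : nat) (g : nat -> int) : (2 * k < L)%N ->
  (forall i, (i < m)%N -> `|g i| <= k)%N ->
  (2 * `|(\sum_(i < m) (L ^ i)%:Z * g i)%R| < L ^ m)%N.
Proof.
move=> kL; elim: m => [|m IH] gk; first by rewrite big_ord0.
rewrite big_ord_recr /= expnS.
have IHm : (2 * `|(\sum_(i < m) (L ^ i)%:Z * g i)%R| < L ^ m)%N.
  by apply: IH => i im; apply: gk; exact: ltnW.
have gm := gk m (leqnn _).
have : (`|((L ^ m)%:Z * g m)%R| <= L ^ m * k)%N by rewrite abszM leq_mul2l gm orbT.
have : (L ^ m * (2 * k).+1 <= L ^ m * L)%N by rewrite leq_mul2l kL orbT.
move: (\sum_(i < m) _) IHm => S; move: (_ * g m) => T; nia.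
Qed.

(** A nonzero leading digit would contribute at least [L^m], more than the lower digits can
    cancel. *)
Lemma radix_sum_eq0 (m L k : nat) (g : nat -> int) : (2 * k < L)%N ->
  (forall i, (i < m)%N -> `|g i| <= k)%N ->
  \sum_(i < m) (L ^ i)%:Z * g i = 0 -> forall i, (i < m)%N -> g i = 0.
Proof.
move=> kL; elim: m => // m IH gk; rewrite big_ord_recr /= => S0.
have gk' i : (i < m)%N -> (`|g i| <= k)%N by move=> im; apply: gk; exact: ltnW.
have lt := radix_sum_lt kL gk'.
have gm : g m = 0.
  apply/eqP; rewrite -absz_eq0 -leqn0 leqNgt; apply/negP => gm0.
  have : (L ^ m * 1 <= `|((L ^ m)%:Z * g m)%R|)%N by rewrite abszM leq_mul2l gm0 orbT.
  move: (\sum_(i < m) _) lt S0 => S; move: (_ * g m) => T; lia.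
move: S0; rewrite gm mulr0 addr0 => /(IH gk') H i.
by rewrite ltnS leq_eqVlt => /orP[/eqP -> //|/H].
Qed.

Variable d : nat.

(* A large multiple of a functional plus a vector of powers of L: the former
   decides the sign unless it vanishes, the latter never vanishes. *)
Definition on_grid (L : nat) (h : 'cV[int]_d) := forall i : 'I_d,
  exists2 a : int, (`|a| <= L ^ d)%N & h i 0 = (L ^ i)%:Z + (L ^ d)%:Z * a.

Lemma pert_sum (L k : nat) (g : 'cV[int]_d) : (2 * k < L)%N -> in_box k g ->
  (2 * `|(\sum_(i < d) (L ^ i)%:Z * g i 0)%R| < L ^ d)%N /\
  (\sum_(i < d) (L ^ i)%:Z * g i 0 = 0 -> g = 0).
Proof.
move=> kL gk; pose g' i := if insub i is Some j then g j 0 else 0.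
have g'E (i : 'I_d) : g' i = g i 0 by rewrite /g' insubT //= => ?; congr (g _ _); exact: val_inj.
have g'k i : (i < d)%N -> (`|g' i| <= k)%N by move=> id; rewrite (g'E (Ordinal id)).
under eq_bigr do rewrite -g'E.
split; first exact: radix_sum_lt kL g'k.
move=> S0; apply/colP => i; rewrite -g'E mxE.
exact: (radix_sum_eq0 kL g'k S0).
Qed.

Lemma mul_grid_vec (L : nat) (h : 'cV[int]_d) (a : 'I_d -> int) (g : 'cV[int]_d) :
  (forall i, h i 0 = (L ^ i)%:Z + (L ^ d)%:Z * a i) ->
  (h^T *m g) 0 0 = \sum_(i < d) (L ^ i)%:Z * g i 0 + (L ^ d)%:Z * \sum_i a i * g i 0.
Proof.
move=> hE; rewrite mxE mulr_sumr -big_split /=; apply: eq_bigr => i _.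
by rewrite mxE hE mulrDl mulrA.
Qed.

Lemma grid_generic (L k : nat) (h g : 'cV[int]_d) : (2 * k < L)%N ->
  on_grid L h -> in_box k g -> g != 0 -> (h^T *m g) 0 0 != 0.
Proof.
move=> kL hg gk g0.
have /boolp.choice [a hE] : forall i : 'I_d, exists a : int, h i 0 = (L ^ i)%:Z + (L ^ d)%:Z * a.
  by move=> i; have [a _ ->] := hg i; exists a.
have [lt neq] := pert_sum kL gk.
rewrite (mul_grid_vec _ hE); apply: contra g0 => /eqP S0; apply/eqP/neq.
move: (\sum_i a i * _) (\sum_i _) lt S0 => T S lt S0.
have [T0|T0] := eqVneq T 0; first by move: S0; rewrite T0 mulr0 addr0.
have : (L ^ d * 1 <= `|((L ^ d)%:Z * T)%R|)%N by rewrite abszM leq_mul2l lt0n absz_eq0 T0 orbT.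
move: (_ * T) S0 => U; lia.
Qed.

(** Here integrality counts: a positive value of [h0] is at least 1, so after multiplication by
    [L^d] it outweighs the perturbation. *)
Lemma grid_refine (L k : nat) (h0 : 'rV[int]_d) : (2 * k < L)%N ->
  (forall i, `|h0 0%R i| <= L ^ d)%N ->
  exists2 h, on_grid L h & forall g, in_box k g -> 0 < (h0 *m g) 0 0 -> 0 < (h^T *m g) 0 0.
Proof.
move=> kL h0N; exists (\col_i ((L ^ i)%:Z + (L ^ d)%:Z * h0 0 i)).
  by move=> i; exists (h0 0 i); rewrite ?mxE.
move=> g gk; rewrite mxE => T0.
rewrite (@mul_grid_vec L _ (h0 0)); last by move=> i; rewrite mxE.
have [lt _] := pert_sum kL gk.
move: (\sum_i h0 0 i * _) (\sum_i _) lt T0 => T S lt T0.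
have : ((L ^ d)%:Z * 1 <= (L ^ d)%:Z * T) by rewrite ler_wpM2l.
move: (_ * T) => U; lia.
Qed.

End Grid.

(** * Maximization of convex functions *)

Section ConvexMax.
Variables (R : realType) (d n : nat) (s : seq 'cV[int]_n) (W : 'M[int]_(d, n)).
Local Notation r := (to_real R).

Lemma convex_max_unique (f : 'cV[R]_d -> R) x :
  @convex_function R 'cV[R]_d setT f -> x \in s ->
  exists x1 (h : 'rV[R]_d), unique_max s W h x1 /\ f (r (W *m x)) <= f (r (W *m x1)).
Proof.
move=> fc xs; set p := r (W *m x).
(* The cone of directions that lead to [p] from points of smaller value. Convexity of [f] closes it
   under sums, a sum pointing to [p] from a weighted mean; it omits 0 because [f p < f p] fails. *)
pose K := [set q | exists (c : R) z, [/\ 0 < c, q = c *: (p - z) & f z < f p]].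
have fconv y z (a b : R) : 0 < a -> 0 < b -> a + b = 1 ->
    f (a *: y + b *: z) <= a * f y + b * f z.
  move=> a0 b0 ab; have a1 : a <= 1 by lra.
  have /andP a01 : (0 <= a) && (a <= 1) by rewrite ltW.
  have [l lE] : exists l : {i01 R}, l%:num = a.
    have H : Itv.spec (@Itv.num_sem R) (Itv.Real `[0%Z, 1%Z]) a.
      by rewrite /= /Itv.num_sem /= num_real in_itv /= ltW.
    by exists (Itv.mk H).
  have := fc l y z (mem_set I) (mem_set I).
  rewrite (_ : b = 1 - l%:num); last by rewrite lE; lra.
  by rewrite -lE.
pose T := [seq p - r (W *m z) | z <- s & f (r (W *m z)) < f p].
have [|||q|h Hh] := @gordan R d K T.
- move=> q1 q2 [c1 [z1 [c10 -> f1]]] [c2 [z2 [c20 -> f2]]].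
  have c0 : 0 < c1 + c2 by rewrite addr_gt0.
  have cn := lt0r_neq0 c0.
  exists (c1 + c2), ((c1 / (c1 + c2)) *: z1 + (c2 / (c1 + c2)) *: z2); split=> //.
    rewrite [RHS]scalerBr [X in _ = _ - X]scalerDr !scalerA ![(c1 + c2) * _]mulrC !divfK //.
    by rewrite scalerDl !scalerBr opprD addrACA.
  have a0 : 0 < c1 / (c1 + c2) by rewrite divr_gt0.
  have b0 : 0 < c2 / (c1 + c2) by rewrite divr_gt0.
  have ab : c1 / (c1 + c2) + c2 / (c1 + c2) = 1 by rewrite -mulrDl divff.
  apply: le_lt_trans (fconv _ _ _ _ a0 b0 ab) _.
  by rewrite -[ltRHS]mul1r -ab mulrDl ltrD // ltr_pM2l.
- move=> a q a0 [c [z [c0 -> fz]]]; exists (a * c), z; split=> //.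
    by rewrite mulr_gt0.
  by rewrite scalerA.
- move=> [c [z [c0 /esym/eqP]]]; rewrite scaler_eq0 gt_eqF //= subr_eq0 => /eqP <-.
  by rewrite ltxx.
- by move=> /mapP[z]; rewrite mem_filter => /andP[fz zs] ->; exists 1, (r (W *m z)); rewrite scale1r.
pose D := [seq r (W *m z - W *m w) | z <- s, w <- s].
have [h0 [h0pos h0neq]] := perturb_generic h T D.
have s0 : s != [::] by apply: contraTneq xs => ->.
have [x1 x1s x1max] := seq_argmax (fun x => ev h0 (r (W *m x))) s0.
exists x1, h0; split.
  split=> // y ys yx; rewrite lt_neqAle x1max // andbT -subr_eq0 -evBr -to_realB.
  by apply: h0neq; [exact: allpairs_f|rewrite to_real_eq0 subr_eq0].
(* A maximizer [x1] of smaller value would belong to [T], so [h0] would be larger at [p] than at its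
   own maximizer. *)
rewrite leNgt; apply/negP => lt.
have x1T : p - r (W *m x1) \in T by apply: (map_f (fun z => p - r (W *m z))); rewrite mem_filter lt.
have := h0pos _ x1T (Hh _ x1T); rewrite evBr subr_gt0 ltNge; by rewrite x1max.
Qed.

End ConvexMax.

(** * Number of vertices *)

Section Count.
Variables (R : realType) (d n : nat) (s : seq 'cV[int]_n) (W : 'M[int]_(d, n)).
Local Notation r := (to_real R).
Local Notation P := (convex_hull (to_real R @` [set` s])).
Variables (e k : nat).
Hypotheses (Pe : edge_bound P e) (ek : (e * mx_norm_oo W <= k)%N).

Lemma unique_max_small (h : 'rV[R]_d) x : (0 < k)%N -> unique_max s W h x ->
  exists h' : 'rV[int]_d, (forall i, `|h' 0%R i| <= d`! * k ^ d.-1)%N /\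
    unique_max s W (r h') x.
Proof.
move=> k0 hx; have [h' [h'B h'pos]] := small_functional k0 h.
by exists h'; split=> //; exact: (unique_max_cone Pe ek hx).
Qed.

Lemma unique_max_grid L (h : 'rV[R]_d) x : (2 * k < L)%N -> (0 < k)%N -> (d`! * k ^ d.-1 <= L ^ d)%N ->
  unique_max s W h x ->
  exists2 h', on_grid L h' & unique_max s W (r h'^T) x.
Proof.
move=> kL k0 LN hx; have [h' [h'B h'x]] := unique_max_small k0 hx.
have [|h2 h2g h2pos] := @grid_refine d L k h' kL.
  by move=> i; exact: leq_trans (h'B i) LN.
exists h2 => //; apply: (unique_max_cone Pe ek h'x) => g gk.
by rewrite !ev_to_real !ltr0z; exact: h2pos.
Qed.

Lemma grid_unique_max L h x : (2 * k < L)%N -> on_grid L h -> x \in s ->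
  (forall y, y \in s -> (h^T *m W *m y) 0 0 <= (h^T *m W *m x) 0 0) ->
  unique_max s W (r h^T) x.
Proof.
move=> kL hg xs xmax; apply: (generic_unique_max Pe ek) => // [g gk g0|y /xmax].
  by rewrite ev_to_real intr_eq0; exact: grid_generic hg gk g0.
by rewrite !ev_to_real !mulmxA ler_int.
Qed.

(** Distinct vertices need distinct small functionals, which lie in a box of radius [B]. Since [B]
    is positive, its side [2 B + 1] is at most [3 B]; the exponent [d] acts on [3 d! k^(d-1)]. *)
Lemma card_vertices_box : (0 < k)%N ->
  vertices (image_polytope R W [set` s]) #<=
    `I_((3 * d`!) ^ d * k ^ (d * d.-1))%N.
Proof.
move=> k0; pose B := (d`! * k ^ d.-1)%N.
pose A := box d B.
(* The default 0 occurs only for functionals without a unique maximizer, which no vertex uses. *)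
pose F i : 'cV[R]_d := xget 0 [set u | exists x, unique_max s W (r (nth 0 A i)^T) x /\ u = r (W *m x)].
have FA : vertices (image_polytope R W [set` s]) `<=` F @` `I_(size A).
  move=> u /(verticesP) [x [h [/(unique_max_small k0) [h' [h'B h'x]] uE]]].
  have /boxP h'A : in_box B h'^T by move=> i; rewrite mxE.
  exists (index h'^T A); first by rewrite /= index_mem.
  rewrite /F nth_index // trmxK.
  set Q := [set u | _]; have : Q (xget 0 Q) by apply: xgetPex; exists u, x.
  move=> [y [[ys hy] ->]]; rewrite uE.
  have [xs hx] := h'x; have [->//|yx] := eqVneq (W *m y) (W *m x).
  have := hx _ ys yx; rewrite eq_sym in yx; have := hy _ xs yx.
  by move=> a /(lt_trans a); rewrite ltxx.
apply: card_le_trans (subset_card_le FA) _.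
apply: card_le_trans (card_image_le _ _) _.
rewrite card_le_II size_box (mulnC d d.-1) expnM -expnMn.
have B0 : (0 < B)%N by rewrite muln_gt0 fact_gt0 expn_gt0 k0.
have [->//|d0] := posnP d; rewrite leq_exp2r //.
by rewrite -mulnA -/B; lia.
Qed.

End Count.

(** * Running times of programs *)

(* [eval] is also a name of MathComp-Analysis. *)
Local Notation eval := Defs.eval.

Fixpoint reads (e : expr) : seq nat :=
  match e with
  | Const _ => [::]
  | Cell a i => a :: reads i
  | Plus e1 e2 | Minus e1 e2 => reads e1 ++ reads e2
  end.

(** Frame condition: [D] lists the arrays that a program may have changed. *)
Definition off (D : seq nat) (s s' : memory) := forall a k, a \notin D -> s' a k = s a k.

Lemma off_trans D s1 s2 s3 : off D s1 s2 -> off D s2 s3 -> off D s1 s3.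
Proof. by move=> h1 h2 a k aD; rewrite h2 // h1. Qed.

Lemma off_sub D D' s s' : {subset D <= D'} -> off D s s' -> off D' s s'.
Proof. by move=> DD' h a k aD; apply: h; apply: contra aD; exact: DD'. Qed.

Lemma off_write D s s' a k z : off D s s' -> a \in D -> off D s (write s' a k z).
Proof.
move=> h aD b j bD; rewrite /write; case: eqP => [ba|_]; last exact: h.
by rewrite ba aD in bD.
Qed.

Lemma eval_off D s s' e : off D s s' -> all (fun a => a \notin D) (reads e) ->
  eval s' e = eval s e.
Proof.
move=> h; elim: e => //= [a i IH /andP[aD /IH ->]|e1 IH1 e2 IH2|e1 IH1 e2 IH2].
- exact: h.
- by rewrite all_cat => /andP[/IH1 -> /IH2 ->].
- by rewrite all_cat => /andP[/IH1 -> /IH2 ->].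
Qed.

Lemma writeE s a k z b j :
  write s a k z b j = if (b == a) && (j == k) then z else s b j.
Proof. by []. Qed.

(** Repetition in the program text, possible because [d] is fixed. Array names cannot be computed at
    run time, so a loop over the arrays [aRow i] has to be unrolled. *)
Fixpoint unroll (m : nat) (F : nat -> prog) : prog :=
  if m is m'.+1 then Seq (unroll m' F) (F m') else Skip.

Definition Var (a : nat) := Cell a (Const 0).

(** The decrement precedes the body, so that the counter runs from [m - 1] to 0 inside the body and
    can serve as an index. *)
Definition Loop (a : nat) (e : expr) (body : prog) :=
  Seq (Store a (Const 0) e)
    (While (Var a) (Seq (Store a (Const 0) (Minus (Var a) (Const 1))) body)).

(** Adds [x y] to a cell by adding or subtracting [y] repeatedly. The time grows with the absolute
    value of [x] alone, so a factor of uncontrolled size belongs in [y]. *)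
Definition MulAdd (a : nat) (i x y : expr) (tmp : nat) :=
  If x (Loop tmp x (Store a i (Plus (Cell a i) y)))
       (Loop tmp (Minus (Const 0) x) (Store a i (Minus (Cell a i) y))).

Section Wp.
Variables (R : realType) (d n : nat).
Variable lin : 'rV[int]_n -> 'cV[int]_n.
Variable cmp : 'cV[R]_d -> 'cV[R]_d -> bool.

(** Total correctness within a time budget; as [T] is only an upper bound, [wp_weaken] can round
    running times up. *)
Definition wp (p : prog) (T : nat) (s : memory) (Q : memory -> Prop) :=
  exists t s', [/\ exec lin cmp p t s s', (t <= T)%N & Q s'].

Lemma wp_weaken p T T' s (Q Q' : memory -> Prop) : wp p T s Q ->
  (T <= T')%N -> (forall s', Q s' -> Q' s') -> wp p T' s Q'.
Proof.
move=> [t [s' [e tT q]]] TT' QQ'; exists t, s'; split=> //; last exact: QQ'.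
exact: leq_trans tT TT'.
Qed.

Lemma wp_skip s (Q : memory -> Prop) : Q s -> wp Skip 1 s Q.
Proof. by exists 1%N, s; split=> //; constructor. Qed.

Lemma wp_store a i e s (Q : memory -> Prop) :
  Q (write s a `|eval s i|%N (eval s e)) -> wp (Store a i e) 1 s Q.
Proof. by move=> q; exists 1%N; eexists; split; [exact: ExecStore| |exact: q]. Qed.

Lemma wp_seq p q T U s (Q : memory -> Prop) :
  wp p T s (fun s' => wp q U s' Q) -> wp (Seq p q) (T + U) s Q.
Proof.
move=> [t [s' [e1 tT [u [s'' [e2 uU q2]]]]]]; exists (t + u)%N, s''; split=> //.
  exact: ExecSeq e1 e2.
exact: leq_add.
Qed.

Lemma wp_if e p q T s (Q : memory -> Prop) :
  (0 < eval s e -> wp p T s Q) -> (eval s e <= 0 -> wp q T s Q) ->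
  wp (If e p q) T.+1 s Q.
Proof.
move=> hp hq; have [e0|e0] := ltP 0 (eval s e).
  have [t [s' [ex tT q']]] := hp e0; exists t.+1, s'; split=> //.
  exact: ExecIfTrue.
have [t [s' [ex tT q']]] := hq e0; exists t.+1, s'; split=> //.
exact: ExecIfFalse.
Qed.

Lemma wp_unroll m F T s (Inv : nat -> memory -> Prop) : Inv 0%N s ->
  (forall i s', (i < m)%N -> Inv i s' -> wp (F i) T s' (Inv i.+1)) ->
  wp (unroll m F) (m * T).+1 s (Inv m).
Proof.
move=> I0; elim: m => [|m IH] IS; first exact: wp_skip.
rewrite mulSn [(T + _)%N]addnC -addSn; apply: wp_seq.
apply: (wp_weaken (IH _) (leqnn _)) => [i s' im|s' Im]; last exact: IS.
by apply: IS; exact: ltnW.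
Qed.

(** [Inv] is indexed by the number of remaining rounds. Each round pays 2 extra steps for test and
    decrement; the final 2 are the initial store and the failing test. *)
Lemma wp_loop a e body T m s (Inv : nat -> memory -> Prop) :
  eval s e = m%:Z -> Inv m (write s a 0 m) ->
  (forall j s', (j < m)%N -> Inv j.+1 s' -> s' a 0%N = j.+1%:Z ->
    wp body T (write s' a 0 j) (fun s'' => s'' a 0%N = j%:Z /\ Inv j s'')) ->
  wp (Loop a e body) (m * T.+2 + 2) s (Inv 0%N).
Proof.
move=> em Im IS; rewrite (_ : (m * T.+2 + 2) = 1 + (m * T.+2).+1)%N; last by lia.
apply/wp_seq/wp_store; rewrite em /=.
move: (write s a 0 m) Im (erefl : write s a 0 m a 0%N = if (a == a) && true then m%:Z else _).
rewrite eqxx /= => {em} s0; elim: m s0 IS => [|m IH] s0 IS Im sa.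
  by exists 1%N, s0; split=> //; constructor; rewrite /= sa.
have [t [s1 [e1 tT [s1a I1]]]] := IS m s0 (leqnn _) Im sa.
have [j s' jm|u [s2 [e2 uU q2]]] := IH s1 _ I1 s1a.
  by apply: IS; exact: ltnW.
exists ((1 + t) + u).+1, s2; split=> //; last by rewrite mulSn; lia.
apply: ExecWhileTrue e2; first by rewrite /= sa.
apply: ExecSeq e1.
have -> : write s0 a 0 m = write s0 a `|eval s0 (Const 0)|%N (eval s0 (Minus (Var a) (Const 1))).
  by congr (write _ _ _ _); rewrite /= sa; lia.
exact: ExecStore.
Qed.

Lemma wp_muladd a i x y tmp s M : (`|eval s x| <= M)%N ->
  all (fun b => b \notin [:: a; tmp]) (reads i ++ reads y) -> tmp != a ->
  wp (MulAdd a i x y tmp) (M * 3 + 3) s (fun s' =>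
    [/\ off [:: a; tmp] s s',
        s' a `|eval s i|%N = s a `|eval s i|%N + eval s x * eval s y &
        forall k, k != `|eval s i|%N -> s' a k = s a k]).
Proof.
rewrite all_cat => xM /andP[ia ya] ta.
have at_ : (a == tmp) = false by rewrite eq_sym (negbTE ta).
(* Both signs of [x] are treated at once: [op] is addition or subtraction, and [b] records the
   sign. *)
have key op (m : nat) (b : bool) e : (`|eval s x| <= M)%N ->
    (forall s', eval s' (op (Cell a i) y) = eval s' (Cell a i) + (-1) ^+ b * eval s' y) ->
    eval s e = m%:Z -> eval s x = (-1) ^+ b * m%:Z ->
    wp (Loop tmp e (Store a i (op (Cell a i) y))) (M * 3 + 2) s (fun s' =>
    [/\ off [:: a; tmp] s s',
        s' a `|eval s i|%N = s a `|eval s i|%N + eval s x * eval s y &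
        forall k, k != `|eval s i|%N -> s' a k = s a k]).
  move=> {}xM opE em xE; have mM : (m <= M)%N by move: xM; rewrite xE abszMsign.
  pose Inv (j : nat) (s' : memory) := [/\ off [:: a; tmp] s s',
        s' a `|eval s i|%N = s a `|eval s i|%N + (-1) ^+ b * (m%:Z - j%:Z) * eval s y &
        forall k, k != `|eval s i|%N -> s' a k = s a k].
  apply: (wp_weaken (@wp_loop _ _ _ 1 m _ Inv em _ _)).
  - split=> [||k _]; rewrite ?writeE ?at_ //=; last by rewrite subrr mulr0 mul0r addr0.
    by apply: off_write => //; rewrite !inE eqxx orbT.
  - move=> j s' jm [ho v w] s'j; apply: wp_store; rewrite opE.
    have o1 : off [:: a; tmp] s (write s' tmp 0 j).
      by apply: off_write => //; rewrite !inE eqxx orbT.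
    rewrite /= (eval_off o1 ia) (eval_off o1 ya).
    split; first by rewrite !writeE (negbTE ta) eqxx.
    split=> [||k kn].
    + by apply: off_write => //; rewrite !inE eqxx.
    + rewrite !writeE !eqxx at_ /= v -addrA; congr (_ + _).
      by rewrite -addn1 PoszD; ring.
    + by rewrite !writeE (negbTE kn) andbF at_ /= w.
  - by rewrite leq_add2r leq_mul2r mM.
  - by move=> s' [ho v w]; split=> //; rewrite v subr0 xE.
rewrite addn3 -addn2; apply: wp_if => x0.
  apply: (key Plus `|eval s x|%N false) => //= [s'||]; rewrite ?expr0 ?mul1r //; lia.
apply: (key Minus `|eval s x|%N true) => //= [s'||]; rewrite ?expr1.
- by rewrite mulN1r.
- by lia.
- by lia.
Qed.

End Wp.

(** * The enumeration algorithm *)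

(* Arrays 0 and 1 are those of the input and of the output. *)
Definition aH := 2%N.
Definition aN := 3%N.
Definition aJ := 4%N.
Definition aT := 5%N.
Definition aC := 6%N.
Definition aX := 7%N.
Definition aP := 8%N.
Definition aFound := 9%N.
Definition aEq := 10%N.
Definition aRem := 11%N.
Definition aBP := 12%N.
Definition aBX := 13%N.
Definition aFlag := 14%N.
Definition aY := 15%N.
(** Three interleaved families, disjoint modulo 3 and above all fixed arrays: the rows of [W], the
    counters of the nested loops, and the powers of [Y]. *)
Definition aRow (i : nat) := (20 + 3 * i)%N.
Definition aCnt (i : nat) := (21 + 3 * i)%N.
Definition aPow (i : nat) := (22 + 3 * i)%N.

Definition query_functional (d : nat) :=
  Loop aJ (Var aN) (Seq (Store aC (Var aJ) (Const 0)) (unroll d (fun i =>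
    MulAdd aC (Var aJ) (Cell (aRow i) (Var aJ)) (Cell aH (Const i)) aT))).

Definition query_image (d : nat) :=
  Seq (unroll d (fun i => Store aP (Const i) (Const 0)))
    (Loop aJ (Var aN) (unroll d (fun i =>
       MulAdd aP (Const i) (Cell (aRow i) (Var aJ)) (Cell aX (Var aJ)) aT))).

Definition query (d : nat) :=
  Seq (query_functional d) (Seq (LinOracle aC aX) (query_image d)).

Section Query.
Variables (R : realType) (d n : nat).
Variable lin : 'rV[int]_n -> 'cV[int]_n.
Variable cmp : 'cV[R]_d -> 'cV[R]_d -> bool.
Local Notation wp := (wp lin cmp).
Variable M : nat.

Definition rows_bounded (s : memory) :=
  forall i j, (i < d)%N -> (j < n)%N -> (`|s (aRow i) j| <= M)%N.

Lemma wp_query_functional (s : memory) : s aN 0%N = n%:Z -> rows_bounded s ->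
  wp (query_functional d) (n * (d * (M * 3 + 3) + 4) + 2) s (fun s' =>
    off [:: aJ; aT; aC] s s' /\ forall j, (j < n)%N ->
    s' aC j = \sum_(i < d) s (aRow i) j * s aH i).
Proof.
move=> sN sM; pose D := [:: aJ; aT; aC].
(* The loop counts down, so the finished columns are those from [k] on. *)
pose Inv k s' := off D s s' /\ forall j, (k <= j)%N -> (j < n)%N ->
    s' aC j = \sum_(i < d) s (aRow i) j * s aH i.
pose T := (1 + (d * (M * 3 + 3)).+1)%N.
apply: (wp_weaken (@wp_loop _ _ _ _ _ _ (Var aN) _ T n s Inv sN _ _)).
- by split=> [|j nj jn]; [exact: off_write|rewrite ltnNge nj in jn].
- move=> k s' kn [ho v] s'k; apply/wp_seq/wp_store.
  pose Inv2 (i : nat) (s' : memory) := [/\ off D s s', s' aJ 0%N = k,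
    s' aC k = \sum_(i' < i) s (aRow i') k * s aH i' &
    forall j, (k < j)%N -> (j < n)%N -> s' aC j = \sum_(i < d) s (aRow i) j * s aH i].
  apply: (wp_weaken (@wp_unroll _ _ _ _ _ d _ (M * 3 + 3) _ Inv2 _ _) (leqnn _)).
  + split=> //; first by do 2!apply: off_write => //.
      by rewrite writeE /= eqxx big_ord0.
    by move=> j kj jn; rewrite !writeE /= gtn_eqF //= v.
  + move=> i s1 id [ho1 s1J s1C s1o].
    have xE : eval s1 (Cell (aRow i) (Var aJ)) = s (aRow i) k.
      by rewrite /= s1J absz_nat ho1.
    apply: (wp_weaken (@wp_muladd _ _ _ _ _ aC _ _ _ aT s1 M _ _ _) (leqnn _)) => //.
      by rewrite xE sM.
    rewrite xE /= s1J absz_nat => s2 [ho2 s2C s2o]; split.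
    * by apply: off_trans ho1 _; apply: off_sub ho2 => a; rewrite !inE => /orP[]->; rewrite ?orbT.
    * by rewrite ho2.
    * by rewrite s2C s1C big_ord_recr /= (ho1 aH).
    * by move=> j kj jn; rewrite s2o ?s1o // gtn_eqF.
  + move=> s2 [ho2 s2J s2C s2o]; split=> //; split=> // j.
    by rewrite leq_eqVlt => /orP[/eqP <- //|]; exact: s2o.
- by rewrite /T; lia.
- by move=> s' [ho v]; split=> // j; exact: v.
Qed.

Lemma wp_query_image (s : memory) : s aN 0%N = n%:Z -> rows_bounded s ->
  wp (query_image d) (d.+1 + (n * (d * (M * 3 + 3) + 3) + 2)) s (fun s' =>
    off [:: aJ; aT; aP] s s' /\ forall i, (i < d)%N ->
    s' aP i = \sum_(0 <= j < n) s (aRow i) j * s aX j).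
Proof.
move=> sN sM; pose D := [:: aJ; aT; aP].
pose Inv0 (k : nat) s' := off D s s' /\ forall i, (i < k)%N -> s' aP i = 0.
apply: wp_seq; rewrite -[X in X.+1]muln1.
apply: (wp_weaken (@wp_unroll _ _ _ _ _ d _ 1 _ Inv0 _ _) (leqnn _)) => //.
  move=> i s' id [ho v]; apply: wp_store; split; first exact: off_write.
  by move=> j; rewrite ltnS writeE /= leq_eqVlt => /orP[->//|/v ->]; rewrite if_same.
move=> {Inv0} s0 [ho0 v0].
pose Inv k s' := off D s s' /\ forall i, (i < d)%N ->
    s' aP i = \sum_(k <= j < n) s (aRow i) j * s aX j.
pose T := (d * (M * 3 + 3)).+1.
apply: (wp_weaken (@wp_loop _ _ _ _ _ _ (Var aN) _ T n s0 Inv _ _ _)).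
- by rewrite /= ho0.
- by split=> [|i id]; [exact: off_write|rewrite big_geq // writeE /= v0].
- move=> k s' kn [ho v] s'k.
  pose Inv2 (i : nat) (s' : memory) := [/\ off D s s', s' aJ 0%N = k,
    forall i', (i' < i)%N -> s' aP i' = \sum_(k <= j < n) s (aRow i') j * s aX j &
    forall i', (i <= i')%N -> (i' < d)%N ->
      s' aP i' = \sum_(k.+1 <= j < n) s (aRow i') j * s aX j].
  apply: (wp_weaken (@wp_unroll _ _ _ _ _ d _ (M * 3 + 3) _ Inv2 _ _) (leqnn _)).
  + split=> //; first exact: off_write.
    by move=> i _ id; rewrite writeE /= v.
  + move=> i s1 id [ho1 s1J s1P s1o].
    have xE : eval s1 (Cell (aRow i) (Var aJ)) = s (aRow i) k.
      by rewrite /= s1J absz_nat ho1.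
    apply: (wp_weaken (@wp_muladd _ _ _ _ _ aP _ _ _ aT s1 M _ _ _) (leqnn _)) => //.
      by rewrite xE sM.
    rewrite xE /= s1J absz_nat => s2 [ho2 s2P s2o]; split.
    * by apply: off_trans ho1 _; apply: off_sub ho2 => a; rewrite !inE => /orP[]->; rewrite ?orbT.
    * by rewrite ho2.
    * move=> i'; rewrite ltnS leq_eqVlt => /orP[/eqP ->|i'i].
        by rewrite s2P s1o // [in RHS]big_ltn // addrC (ho1 aX).
      by rewrite s2o ?s1P // ltn_eqF.
    * by move=> i' ii' i'd; rewrite s2o ?gtn_eqF // s1o // ltnW.
  + by move=> s2 [ho2 s2J s2C s2o]; split.
- by rewrite /T; lia.
- by move=> s' [ho v]; split=> // j; exact: v.
Qed.

Definition query_time := (n * (2 * (d * (M * 3 + 3)) + 8) + d + 6)%N.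

Lemma wp_query (s : memory) : s aN 0%N = n%:Z -> rows_bounded s ->
  wp (query d) query_time s (fun s' =>
    [/\ off [:: aJ; aT; aC; aX; aP] s s',
        read_vec n s' aX = lin (\row_(j < n) \sum_(i < d) s (aRow i) j * s aH i) &
        forall i, (i < d)%N -> s' aP i = \sum_(0 <= j < n) s (aRow i) j * s' aX j]).
Proof.
move=> sN sM.
pose T1 := (n * (d * (M * 3 + 3) + 4) + 2)%N.
pose T2 := (d.+1 + (n * (d * (M * 3 + 3) + 3) + 2))%N.
suff : wp (query d) (T1 + (n.+1 + T2)) s (fun s' =>
    [/\ off [:: aJ; aT; aC; aX; aP] s s',
        read_vec n s' aX = lin (\row_(j < n) \sum_(i < d) s (aRow i) j * s aH i) &
        forall i, (i < d)%N -> s' aP i = \sum_(0 <= j < n) s (aRow i) j * s' aX j]).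
  by move=> /wp_weaken; apply=> //; rewrite /T1 /T2 /query_time; nia.
apply: wp_seq; apply: (wp_weaken (wp_query_functional sN sM) (leqnn _)) => s1 [ho1 C1].
apply: wp_seq; exists n.+1; eexists; split; [exact: ExecLinOracle|by []|].
set v := lin _; have vE : v = lin (\row_(j < n) \sum_(i < d) s (aRow i) j * s aH i).
  by congr (lin _); apply/rowP => j; rewrite !mxE C1.
have ho2 : off [:: aJ; aT; aC; aX; aP] s (write_vec s1 aX v).
  move=> a k; rewrite !inE !negb_or => /and5P[a1 a2 a3 a4 a5].
  by rewrite /write_vec (negbTE a4) ho1 // !inE !negb_or a1 a2 a3.
have X2 : read_vec n (write_vec s1 aX v) aX = v.
  by apply/colP => j; rewrite mxE /write_vec eqxx valK; congr (v _ _); exact: val_inj.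
apply: (wp_weaken (wp_query_image _ _) (leqnn _)).
- by rewrite ho2.
- by move=> i j id jn; rewrite ho2 // sM.
move=> s3 [ho3 P3]; have ho4 : off [:: aJ; aT; aC; aX; aP] (write_vec s1 aX v) s3.
  by apply: off_sub ho3 => a; rewrite !inE => /or3P[]->; rewrite ?orbT.
split.
- exact: off_trans ho2 ho4.
- by rewrite -vE -X2; apply/colP => j; rewrite !mxE ho3.
- by move=> i id; rewrite P3 //; apply: eq_bigr => j _; rewrite ho2 // (ho3 aX).
Qed.

End Query.

(** * Nested loops over the grid *)

Section Nest.
Variable d : nat.

(** With [L = Y^2] and [N = L^d], the three powers read here and in [grid_step] are [L^i], [N^2] and
    [N]. A coordinate [L^i + N a] thus starts at [a = -N] and increases [a] by 1 in each of
    [2 N + 1] rounds. *)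
Definition grid_start i := Minus (Var (aPow (2 * i))) (Var (aPow (4 * d))).
Definition grid_step := Var (aPow (2 * d)).
Definition grid_count := Plus (Const 1) (Plus grid_step grid_step).

Fixpoint nest (body : prog) (m : nat) : prog :=
  if m is i.+1 then
    Seq (Store aH (Const i) (grid_start i))
      (Loop (aCnt i) grid_count
        (Seq (nest body i) (Store aH (Const i) (Plus (Cell aH (Const i)) grid_step))))
  else body.

Fixpoint nest_time (N T m : nat) : nat :=
  if m is i.+1 then ((2 * N + 1) * (nest_time N T i + 1).+2 + 3)%N else T.

Variables (R : realType) (n : nat).
Variable lin : 'rV[int]_n -> 'cV[int]_n.
Variable cmp : 'cV[R]_d -> 'cV[R]_d -> bool.
Local Notation wp := (wp lin cmp).
Variable Y : nat.

Definition powers (s : memory) := forall i, (i <= 4 * d)%N -> s (aPow i) 0%N = (Y ^ i)%N%:Z.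

(** The loops themselves write only to [aH] and to their counters; invariants must survive these
    writes. *)
Definition loop_stable (Q : memory -> Prop) :=
  forall s a k z, a = aH \/ (exists i, a = aCnt i) -> Q s -> Q (write s a k z).

Local Notation L := (Y ^ 2)%N.
Local Notation N := (L ^ d)%N.
Definition grid_coord (i : nat) (z : int) :=
  exists2 a : int, (`|a| <= N)%N & z = (L ^ i)%:Z + N%:Z * a.

Variables (P : memory -> Prop) (cov : 'cV[int]_d -> memory -> Prop) (body : prog) (T : nat).
Hypothesis P_stable : loop_stable P.
Hypothesis cov_stable : forall h, loop_stable (cov h).
Hypothesis P_pow : forall s, P s -> powers s.
Hypothesis wp_body : forall s, P s -> on_grid L (read_vec d s aH) ->
  wp body T s (fun s' => [/\ P s', cov (read_vec d s aH) s',
    forall h, cov h s -> cov h s',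
    forall i, s' aH i = s aH i & forall i, s' (aCnt i) 0%N = s (aCnt i) 0%N]).

(** [P] is an invariant, and [cov h] means that [h] has been dealt with; kept abstract, they serve
    both programs. The induction fixes the coordinates from [m] on and needs the inner loops to
    preserve them and the outer counters. *)
Lemma wp_nest m s : (m <= d)%N -> P s ->
  (forall i, (m <= i < d)%N -> grid_coord i (s aH i)) ->
  wp (nest body m) (nest_time N T m) s (fun s' => [/\ P s',
    forall h, cov h s -> cov h s',
    forall h : 'cV[int]_d, (forall i : 'I_d, (i < m)%N -> grid_coord i (h i 0)) ->
      (forall i : 'I_d, (m <= i)%N -> h i 0 = s aH i) -> cov h s',
    forall i, (m <= i)%N -> s' aH i = s aH i &
    forall i, (m <= i)%N -> s' (aCnt i) 0%N = s (aCnt i) 0%N]).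
Proof.
elim: m s => [|m IH] s md Ps Hs.
  have og : on_grid L (read_vec d s aH) by move=> i; rewrite mxE; apply: Hs; rewrite /= ltn_ord.
  apply: (wp_weaken (wp_body Ps og) (leqnn _)) => s' [Ps' c cc hH hC]; split=> //.
  move=> h _ hE; suff -> : h = read_vec d s aH by [].
  by apply/colP => i; rewrite mxE hE.
set T1 := nest_time N T m in IH *.
rewrite [nest_time _ _ _]/= -/T1 (_ : (_ * _ + 3 = 1 + ((2 * N + 1) * (T1 + 1).+2 + 2))%N); last by lia.
apply/wp_seq/wp_store.
have p2m : s (aPow (2 * m)) 0%N = (L ^ m)%N by rewrite P_pow // ?expnM //; lia.
have p2d s1 : P s1 -> s1 (aPow (2 * d)) 0%N = N by move=> P1; rewrite P_pow // ?expnM //; lia.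
have p4d : s (aPow (4 * d)) 0%N = (N * N)%N.
  by rewrite P_pow // -expnM -expnD; congr (Posz (_ ^ _)%N); lia.
rewrite /= p2m p4d.
set s0 := write _ _ _ _.
have Ps0 : P s0 by apply: P_stable => //; left.
pose c := (2 * N + 1)%N.
(* The value of coordinate [m] with [j] rounds left: from [j = 2 N + 1] down to 1 the factor runs
   from [-N] to [N]. At [j = 0] it has overshot by one step, after the last body. *)
pose z j : int := (L ^ m)%N%:Z + N%:Z * (N%:Z + 1 - j%:Z).
pose Inv (j : nat) s' := [/\ P s', forall h, cov h s -> cov h s', s' aH m = z j,
  forall h : 'cV[int]_d, (forall i : 'I_d, (i < m)%N -> grid_coord i (h i 0)) ->
      (forall i : 'I_d, i = m :> nat -> exists2 j' : nat, (j < j' <= c)%N & h i 0 = z j') ->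
      (forall i : 'I_d, (m < i)%N -> h i 0 = s aH i) -> cov h s' &
  (forall i, (m < i)%N -> s' aH i = s aH i) /\
  (forall i, (m < i)%N -> s' (aCnt i) 0%N = s (aCnt i) 0%N)].
have cntE : eval s0 grid_count = c.
  by rewrite /= (p2d _ Ps0) /c; lia.
apply: (wp_weaken (@wp_loop _ _ _ _ _ _ _ _ _ c s0 Inv cntE _ _) (leqnn _)).
- split.
  + by apply: P_stable => //; right; exists m.
  + move=> h ch; apply: cov_stable; first by right; exists m.
    by apply: cov_stable => //; left.
  + by rewrite writeE /= /s0 writeE !eqxx /= /z /c; lia.
  + move=> h _ /(_ (Ordinal md) erefl) [j']; lia.
  + split=> i mi; first by rewrite writeE /= /s0 writeE /= gtn_eqF.
    by rewrite writeE /= (_ : aCnt i == aCnt m = false) //; apply/eqP; rewrite /aCnt; lia.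
- move=> j s1 jc [P1 c1 H1 v1 [q1 q1']] s1j.
  set s2 := write s1 _ _ _.
  have P2 : P s2 by apply: P_stable => //; right; exists m.
  have cov2 h : cov h s1 -> cov h s2 by apply: cov_stable; right; exists m.
  have H2 i : s2 aH i = s1 aH i by [].
  apply: wp_seq; apply: (wp_weaken (IH s2 (ltnW md) P2 _) (leqnn _)) => [i /andP[mi id]|].
    move: mi; rewrite leq_eqVlt => /orP[/eqP <-|mi].
      by rewrite H2 H1; exists (N%:Z + 1 - j.+1%:Z) => //; rewrite /c in jc; lia.
    by rewrite H2 q1 //; apply: Hs; rewrite mi.
  move=> s3 [P3 c3 v3 o3 o3']; apply: wp_store.
  rewrite /= (p2d _ P3) o3 // H2 H1.
  set s4 := write _ _ _ _.
  have cov4 h : cov h s3 -> cov h s4 by apply: cov_stable; left.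
  split; first by rewrite /s4 writeE /= o3' // /s2 writeE !eqxx.
  split.
  + by apply: P_stable => //; left.
  + by move=> h /c1 /cov2 /c3 /cov4.
  + rewrite /s4 writeE !eqxx /= /z (_ : j.+1%:Z = j%:Z + 1); [ring|lia].
  + move=> h hlow hm hup; have [j' /andP[jj' j'c] hmE] := hm (Ordinal md) erefl.
    have [j'E|j'E] := eqVneq j' j.+1; last first.
      apply/cov4/c3/cov2/v1 => // i im; exists j'; first by lia.
      by rewrite -hmE; congr (h _ _); exact: val_inj.
    apply/cov4/v3 => // i; rewrite leq_eqVlt => /orP[/eqP mi|mi].
      by rewrite H2 -mi H1 -j'E -hmE; congr (h _ _); exact: val_inj.
    by rewrite H2 q1 // hup.
  + split=> i mi; first by rewrite /s4 writeE /= gtn_eqF //= o3 ?H2 ?q1 // ltnW.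
    rewrite /s4 writeE /= o3' ?(ltnW mi) // /s2 writeE (_ : aCnt i == aCnt m = false) ?q1' //.
    by apply/eqP; rewrite /aCnt; lia.
- move=> s' [P' c' _ v' [q' q'']]; split=> // h hlow hup; apply: v' => //.
  + by move=> i im; apply: hlow; rewrite ltnS ltnW.
  + move=> i im; have [|a aN ->] := hlow i; first by rewrite im.
    by exists `|(N%:Z + 1 - a)%R|%N; rewrite /c ?im /z; lia.
Qed.

Lemma wp_nest_all s : P s ->
  wp (nest body d) (nest_time N T d) s (fun s' => P s' /\
    forall h : 'cV[int]_d, on_grid L h -> cov h s').
Proof.
move=> Ps; apply: (wp_weaken (wp_nest (leqnn _) Ps _) (leqnn _)) => [i|s' [P' _ v' _ _]].
  by case/andP => di /(leq_ltn_trans di); rewrite ltnn.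
split=> // h hg; apply: v' => i; first by move=> _; exact: hg.
by rewrite leqNgt ltn_ord.
Qed.

End Nest.

(** * Initialization *)

Fixpoint scale (m : nat) (e : expr) : expr :=
  if m is m'.+1 then Plus (scale m' e) e else Const 0.

Lemma eval_scale m e s : eval s (scale m e) = m%:Z * eval s e.
Proof. by elim: m => [|m IH] /=; rewrite ?mul0r // IH intS; ring. Qed.

(** [scale d] computes the address without a multiplication. [aY] accumulates the absolute values of
    all entries: this bounds the norm of [W] from above and exceeds it at most by the factor
    [n d]. *)
Definition init_rows (d : nat) :=
  Loop aJ (Var aN) (unroll d (fun i =>
    Seq (Store (aRow i) (Var aJ) (Cell 1 (Plus (scale d (Var aJ)) (Const i))))
        (If (Cell (aRow i) (Var aJ))
            (Store aY (Const 0) (Plus (Var aY) (Cell (aRow i) (Var aJ))))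
            (Store aY (Const 0) (Minus (Var aY) (Cell (aRow i) (Var aJ))))))).

Definition init_powers (m : nat) :=
  Seq (Store (aPow 0) (Const 0) (Const 1))
    (unroll m (fun i => Seq (Store (aPow i.+1) (Const 0) (Const 0))
      (MulAdd (aPow i.+1) (Const 0) (Var aY) (Var (aPow i)) aT))).

(** Arrays 0 and 1 hold the input and later the output, so [n], [e] and [W] are moved away before
    the list length is set to 0. *)
Definition init (d : nat) :=
  Seq (Store aN (Const 0) (Cell 0 (Const 0)))
  (Seq (Store aY (Const 0) (Plus (Cell 0 (Const 1)) (Const (d`!.+1)%N)))
  (Seq (init_rows d) (Seq (init_powers (4 * d)) (Store 0 (Const 0) (Const 0))))).

Section Init.
Variables (R : realType) (d n : nat).
Variable lin : 'rV[int]_n -> 'cV[int]_n.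
Variable cmp : 'cV[R]_d -> 'cV[R]_d -> bool.
Local Notation wp := (wp lin cmp).

Lemma aRow_neq i k : i != k -> (aRow i == aRow k) = false.
Proof. by move=> ik; apply/eqP; rewrite /aRow; lia. Qed.

Lemma aPow_neq i k : i != k -> (aPow i == aPow k) = false.
Proof. by move=> ik; apply/eqP; rewrite /aPow; lia. Qed.

Lemma aRow_aPow i k : (aRow i == aPow k) = false.
Proof. by apply/eqP; rewrite /aRow /aPow; lia. Qed.

Lemma wp_init_rows (s : memory) M y0 : s aN 0%N = n%:Z -> s aY 0%N = y0%:Z ->
  (forall i j, (i < d)%N -> (j < n)%N -> (`|s 1%N (j * d + i)%N| <= M)%N) ->
  wp (init_rows d) (n * (d * 3 + 3) + 2) s (fun s' => exists y : nat,
    [/\ s' aY 0%N = y%:Z, (y0 <= y <= y0 + n * d * M)%N, s' aN 0%N = n%:Z &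
     forall i j, (i < d)%N -> (j < n)%N ->
       s' (aRow i) j = s 1%N (j * d + i)%N /\ (y0 + `|s 1%N (j * d + i)| <= y)%N]).
Proof.
move=> sN sY sM.
pose good (m : nat) (y : nat) (s' : memory) := [/\ s' aY 0%N = y%:Z,
  (y0 <= y <= y0 + m * M)%N, s' aN 0%N = n%:Z & forall k, s' 1%N k = s 1%N k].
pose ok (y : nat) (s' : memory) i j :=
  s' (aRow i) j = s 1%N (j * d + i)%N /\ (y0 + `|s 1%N (j * d + i)%N| <= y)%N.
pose Inv j s' := exists y : nat, good ((n - j) * d)%N y s' /\
  forall i k, (i < d)%N -> (j <= k < n)%N -> ok y s' i k.
apply: (wp_weaken (@wp_loop _ _ _ _ _ _ (Var aN) _ (d * 3).+1 n s Inv sN _ _)).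
- exists y0; rewrite subnn; split=> [|i k _]; last by lia.
  by split=> //; rewrite leqnn leq_addr.
- move=> j s' jn [y [[yY yB N1 O1] G]] s'j.
  pose Inv2 m s' := exists y : nat, [/\ good ((n - j.+1) * d + m)%N y s', s' aJ 0%N = j%:Z,
    forall i k, (i < d)%N -> (j < k < n)%N -> ok y s' i k &
    forall i, (i < m)%N -> ok y s' i j].
  apply: (wp_weaken (@wp_unroll _ _ _ _ _ d _ 3 _ Inv2 _ _) (leqnn _)).
  + by exists y; split=> //; rewrite addn0; split.
  + move=> m s1 md [y1 [[yY1 yB1 N2 O2] J1 G1 G2]].
    pose v := s 1%N (j * d + m)%N.
    have vM : (`|v| <= M)%N by exact: sM.
    rewrite (_ : 3 = 1 + 2)%N //; apply/wp_seq/wp_store.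
    rewrite /= eval_scale /= J1 absz_nat.
    have -> : `|(d%:Z * j%:Z + m%:Z)%R|%N = (j * d + m)%N by lia.
    rewrite O2 -/v; set s2 := write _ _ _ _.
    have s2v : s2 (aRow m) j = v by rewrite /s2 writeE !eqxx.
    have s2J : s2 aJ 0%N = j%:Z by rewrite /s2 writeE.
    have s2Y : s2 aY 0%N = y1%:Z by rewrite /s2 writeE.
    have fin z : z = (y1 + `|v|)%N%:Z -> Inv2 m.+1 (write s2 aY 0 z).
      move=> ->; exists (y1 + `|v|)%N; split.
      * split=> //; first by rewrite addnS mulSn; move: yB1 => /andP[]; lia.
      * by rewrite !writeE.
      * move=> i k id jkn; have [r1 r2] := G1 i k id jkn; split; last by lia.
        rewrite -r1 writeE /= /s2 writeE; case: ifP => // /andP[_ /eqP kj]; lia.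
      * move=> i; rewrite ltnS leq_eqVlt => /orP[/eqP ->|im].
          by split; [rewrite writeE /= s2v|rewrite -/v; move: yB1; lia].
        have [r1 r2] := G2 i im; split; last by lia.
        by rewrite -r1 writeE /= /s2 writeE aRow_neq // ltn_eqF.
    apply: wp_if; rewrite /= s2J absz_nat s2v => v0; apply: wp_store; apply: fin.
      by rewrite /= s2J absz_nat s2v s2Y; lia.
    by rewrite /= s2J absz_nat s2v s2Y; lia.
  + move=> s2 [y2 [g2 J2 G1 G2]]; split=> //; exists y2; split.
      by move: g2; rewrite -(_ : (n - j.+1) * d + d = (n - j) * d)%N //; nia.
    move=> i k id /andP[]; rewrite leq_eqVlt => /orP[/eqP <- _|jk kn]; first exact: G2.
    by apply: G1 => //; rewrite jk.
- by lia.
- move=> s' [y [[yY yB N1 O1] G]]; exists y; rewrite subn0 in yB.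
  by split=> // i j id jn; apply: G.
Qed.

Lemma wp_init_powers (s : memory) (Y m : nat) : s aY 0%N = Y%:Z ->
  wp (init_powers m) (m * (Y * 3 + 4) + 2) s (fun s' =>
    (forall i, (i <= m)%N -> s' (aPow i) 0%N = (Y ^ i)%N%:Z) /\
    (forall a k, a != aT -> (forall i, a == aPow i = false) -> s' a k = s a k)).
Proof.
move=> sY; rewrite (_ : _ + 2 = 1 + (m * (Y * 3 + 4)).+1)%N; last by lia.
apply/wp_seq/wp_store => /=.
pose Inv j s' := (forall i, (i <= j)%N -> s' (aPow i) 0%N = (Y ^ i)%N%:Z) /\
    (forall a k, a != aT -> (forall i, a == aPow i = false) -> s' a k = s a k).
apply: (@wp_unroll _ _ _ _ _ m _ (Y * 3 + 4) _ Inv).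
  split=> [i|a k aT' aP']; last by rewrite writeE aP'.
  by rewrite leqn0 => /eqP ->.
move=> i s' im [v w]; rewrite (_ : Y * 3 + 4 = 1 + (Y * 3 + 3))%N; last by lia.
apply/wp_seq/wp_store => /=; set s1 := write _ _ _ _.
have s1Y : s1 aY 0%N = Y by rewrite /s1 writeE /= w.
apply: (wp_weaken (@wp_muladd _ _ _ _ _ (aPow i.+1) _ _ _ aT s1 Y _ _ _) (leqnn _)) => //.
- by rewrite /= s1Y.
- rewrite /= !inE andbT negb_or andbT; apply/eqP; rewrite /aPow; lia.
move=> s2 /= [ho2 v2 w2]; split=> [j|a k aT' aP'].
  rewrite leq_eqVlt => /orP[/eqP ->|ji].
    have ne : (aPow i == aPow i.+1) = false by rewrite aPow_neq // ltn_eqF.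
    have s1i : s1 (aPow i) 0%N = (Y ^ i)%N.
      by rewrite /s1 writeE ne /= v.
    rewrite v2 s1Y s1i {1}/s1 writeE eqxx /= add0r.
    by rewrite expnS PoszM.
  have ne : (aPow j == aPow i.+1) = false by rewrite aPow_neq // ltn_eqF.
  have nT : (aPow j == aT) = false by apply/eqP; rewrite /aPow /aT; lia.
  by rewrite ho2 ?inE ?ne ?nT // /s1 writeE ne /= v.
by rewrite ho2 ?inE ?negb_or ?aP' // /s1 writeE aP' /= w.
Qed.

Definition init_time (y : nat) := (n * (d * 3 + 3) + 4 * d * (y * 3 + 4) + 7)%N.

Lemma wp_init (W : 'M[int]_(d, n)) e :
  let ymax := (e + d`!.+1 + n * d * mx_norm_oo W)%N in
  wp (init d) (init_time ymax) (input W e) (fun s => exists Y : nat,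
    [/\ (e + d`!.+1 + mx_norm_oo W <= Y <= ymax)%N, s aN 0%N = n%:Z,
        forall (i : 'I_d) (j : 'I_n), s (aRow i) j = W i j, powers d Y s & s 0%N 0%N = 0]).
Proof.
move=> ymax; pose M := mx_norm_oo W.
have WE (i : 'I_d) (j : 'I_n) : input W e 1%N (j * d + i)%N = W i j.
  have d0 : (0 < d)%N by case: (d) i => [[]|].
  rewrite /input modnMDl modn_small // divnMDl // divn_small // addn0.
  by rewrite (valK i) (valK j).
have -> : init_time ymax = (1 + (1 + ((n * (d * 3 + 3) + 2) + ((4 * d * (ymax * 3 + 4) + 2) + 1))))%N.
  by rewrite /init_time; lia.
apply/wp_seq/wp_store/wp_seq/wp_store => /=.
set s1 := write _ _ _ _.
have s1Y : s1 aY 0%N = (e + d`!.+1)%N by [].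
apply: wp_seq.
apply: (wp_weaken (@wp_init_rows s1 M _ _ s1Y _) (leqnn _)) => //.
  move=> i j id jn.
  have -> : s1 1%N (j * d + i)%N = W (Ordinal id) (Ordinal jn) by exact: (WE (Ordinal id) (Ordinal jn)).
  exact: mx_norm_ooP.
move=> s2 [Y [Y2 Yb N2 G2]].
have G (i : 'I_d) (j : 'I_n) : s2 (aRow i) j = W i j /\ (e + d`!.+1 + `|W i j| <= Y)%N.
  by have := G2 i j (ltn_ord i) (ltn_ord j); rewrite [s1 1%N _]WE.
have Y1 : (e + d`!.+1 + mx_norm_oo W <= Y <= ymax)%N.
  case/andP: Yb => Yb1 ->; rewrite andbT -leq_subRL //.
  apply/bigmax_leqP => i _; apply/bigmax_leqP => j _.
  by rewrite leq_subRL //; have [] := G i j.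
apply: wp_seq.
apply: (wp_weaken (wp_init_powers (4 * d) Y2)).
  by case/andP: Y1 => _ h; rewrite leq_add2r leq_mul2l leq_add2r leq_mul2r h !orbT.
move=> s3 [P3 O3]; apply: wp_store; exists Y; split=> //.
- by rewrite writeE /= O3.
- move=> i j; have [<- _] := G i j.
  rewrite writeE /=; apply: O3 => // k; exact: aRow_aPow.
Qed.

End Init.

(** * Processing one functional *)

Definition out_cell (d : nat) (k : expr) (i : nat) := Plus (scale d k) (Const i).

(** Tests detect only positive values, so inequality is checked through both differences. *)
Definition compare_entry (d i : nat) :=
  Seq (If (Minus (Cell 1 (out_cell d (Var aRem) i)) (Cell aP (Const i)))
          (Store aEq (Const 0) (Const 0)) Skip)
      (If (Minus (Cell aP (Const i)) (Cell 1 (out_cell d (Var aRem) i)))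
          (Store aEq (Const 0) (Const 0)) Skip).

Definition scan (d : nat) :=
  Seq (Store aFound (Const 0) (Const 0))
    (Loop aRem (Var 0) (Seq (Store aEq (Const 0) (Const 1))
      (Seq (unroll d (compare_entry d))
           (If (Var aEq) (Store aFound (Const 0) (Const 1)) Skip)))).

Definition append (d : nat) :=
  Seq (unroll d (fun i => Store 1 (out_cell d (Var 0) i) (Cell aP (Const i))))
      (Store 0 (Const 0) (Plus (Var 0) (Const 1))).

(** Many grid functionals return the same vertex; searching the list first keeps it free of
    repetitions. *)
Definition collect (d : nat) :=
  Seq (query d) (Seq (scan d) (If (Var aFound) Skip (append d))).

Definition copy (a b : nat) := Loop aJ (Var aN) (Store b (Var aJ) (Cell a (Var aJ))).

Definition keep (d : nat) :=
  Seq (unroll d (fun i => Store aBP (Const i) (Cell aP (Const i)))) (copy aX aBX).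

Definition improve (d : nat) :=
  Seq (query d) (Seq (CmpOracle aBP aP aFlag (Const 0)) (If (Var aFlag) (keep d) Skip)).

Section Bodies.
Variables (R : realType) (d n : nat).
Variable lin : 'rV[int]_n -> 'cV[int]_n.
Variable cmp : 'cV[R]_d -> 'cV[R]_d -> bool.
Local Notation wp := (wp lin cmp).
Variables (W : 'M[int]_(d, n)) (Y : nat).

Definition base (s : memory) := [/\ s aN 0%N = n%:Z,
  forall (i : 'I_d) (j : 'I_n), s (aRow i) j = W i j & powers d Y s].

Lemma base_off D s s' : all (fun a => (a < 20)%N && (a != aN)) D ->
  off D s s' -> base s -> base s'.
Proof.
move=> /allP DP h [sN sW sP]; split.
- by rewrite h //; apply/negP => /DP.
- move=> i j; rewrite h ?sW //; apply/negP => /DP.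
  by rewrite /aRow; case/andP; lia.
- move=> i im; rewrite h ?sP //; apply/negP => /DP.
  by rewrite /aPow; case/andP; lia.
Qed.

Lemma base_loop_stable : loop_stable base.
Proof.
move=> s a k z aE [sN sW sP]; split.
- by rewrite writeE; case: aE => [->|[i ->]] //; rewrite /aCnt; case: eqP => //; lia.
- move=> i j; rewrite writeE ifF ?sW //; apply/andP => -[/eqP + _].
  by case: aE => [->|[l ->]]; rewrite /aRow /aCnt /aH; lia.
- move=> i im; rewrite writeE ifF ?sP //; apply/andP => -[/eqP + _].
  by case: aE => [->|[l ->]]; rewrite /aPow /aCnt /aH; lia.
Qed.

Definition answer (h : 'cV[int]_d) := lin (h^T *m W).

Definition query_bound := query_time d n (mx_norm_oo W).

Lemma wp_answer s : base s ->
  wp (query d) query_bound s (fun s' =>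
    [/\ off [:: aJ; aT; aC; aX; aP] s s',
        read_vec n s' aX = answer (read_vec d s aH) &
        read_vec d s' aP = W *m answer (read_vec d s aH)]).
Proof.
move=> [sN sW _].
have sM : rows_bounded d n (mx_norm_oo W) s.
  by move=> i j id jn; have := sW (Ordinal id) (Ordinal jn) => /= ->; exact: mx_norm_ooP.
apply: (wp_weaken (wp_query lin cmp sN sM) (leqnn _)) => s' [ho X P].
have XE : read_vec n s' aX = answer (read_vec d s aH).
  rewrite X; congr (lin _); apply/rowP => j; rewrite !mxE; apply: eq_bigr => i _.
  by rewrite !mxE sW mulrC.
split=> //; rewrite -XE; apply/colP => i; rewrite !mxE P //.
by rewrite big_mkord; apply: eq_bigr => j _; rewrite !mxE sW.
Qed.

Definition out_vec (s : memory) k : 'cV[int]_d := \col_(i < d) s 1%N (k * d + i)%N.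

Lemma eval_out_cell s k i (c : nat) : eval s k = c%:Z ->
  `|eval s (out_cell d k i)|%N = (c * d + i)%N.
Proof. by move=> kc; rewrite /= eval_scale kc; lia. Qed.

Lemma wp_scan (s : memory) (c : nat) : s 0%N 0%N = c%:Z ->
  wp (scan d) (c * (d * 4 + 6) + 3) s (fun s' => off [:: aFound; aRem; aEq] s s' /\
    s' aFound 0%N = (read_vec d s aP \in output_list d s)%:Z).
Proof.
move=> sc; rewrite addnS; apply: (@wp_seq _ _ _ _ _ _ _ 1); apply/wp_store => /=.
set s0 := write _ _ _ _; pose D := [:: aFound; aRem; aEq].
have ho0 : off D s s0 by exact: off_write.
pose p := read_vec d s aP.
pose Inv j s' := off D s s' /\
  s' aFound 0%N = (p \in [seq out_vec s k | k <- iota j (c - j)])%:Z.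
have s0c : eval s0 (Var 0) = c%:Z by rewrite /= ho0.
apply: (wp_weaken (@wp_loop _ _ _ _ _ _ _ _ (1 + ((d * 4).+1 + 2)) c s0 Inv s0c _ _)).
- by split; [exact: off_write|rewrite subnn].
- move=> j s1 jc [ho1 F1] s1j; apply/wp_seq/wp_store => /=; set s2 := write _ _ _ _.
  have ho2 : off D s s2 by do 2!apply: off_write => //.
  pose eqs m := all (fun i => s 1%N (j * d + i)%N == s aP i) (iota 0 m).
  pose Inv2 m s' := [/\ off D s s', s' aRem 0%N = j%:Z,
    s' aFound 0%N = s1 aFound 0%N & s' aEq 0%N = (eqs m)%:Z].
  apply: wp_seq.
  apply: (wp_weaken (@wp_unroll _ _ _ _ _ d _ 4 _ Inv2 _ _) (leqnn _)) => //.
    move=> i s3 id [ho3 R3 F3 E3].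
    have val s4 : off D s s4 -> s4 aRem 0%N = j%:Z ->
        eval s4 (Cell 1 (out_cell d (Var aRem) i)) = s 1%N (j * d + i)%N /\
        eval s4 (Cell aP (Const i)) = s aP i.
      move=> ho4 R4; split; last by rewrite /= ho4.
      have oc := @eval_out_cell s4 (Var aRem) i j R4.
      by rewrite -[LHS]/(s4 1%N `|eval s4 (out_cell d (Var aRem) i)|%N) oc ho4.
    have eqsS : eqs i.+1 = eqs i && (s 1%N (j * d + i)%N == s aP i).
      by rewrite /eqs -[i.+1]addn1 iotaD all_cat /= andbT.
    have dif s4 x y : eval s4 (Minus x y) = eval s4 x - eval s4 y by [].
    have [v1 v2] := val s3 ho3 R3.
    rewrite (_ : 4 = 2 + 2)%N //; apply: wp_seq; apply: wp_if.
      rewrite dif v1 v2 => lt.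
      apply: wp_store => /=; set s4 := write _ _ _ _.
      have ho4 : off D s s4 by exact: off_write.
      have [v3 v4] := val s4 ho4 R3.
      apply: wp_if.
        rewrite dif v3 v4; lia.
      move=> _; apply: wp_skip; split=> //.
      by rewrite /s4 writeE /= eqsS; case: eqP => [E|]; [lia|rewrite andbF].
    rewrite dif v1 v2 => le.
    apply: wp_skip; apply: wp_if.
      rewrite dif v1 v2 => lt.
      apply: wp_store => /=; split=> //; first exact: off_write.
      by rewrite writeE /= eqsS; case: eqP => [E|]; [lia|rewrite andbF].
    rewrite dif v1 v2 => ge.
    apply: wp_skip; split=> //; rewrite E3 eqsS (_ : _ == _ = true) ?andbT //.
    by apply/eqP; lia.
  move=> s3 [ho3 R3 F3 E3].
  have eqsE : eqs d = (p == out_vec s j).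
    apply/allP/eqP => [H|pE i].
      by apply/colP => i; rewrite !mxE; apply/esym/eqP/H; rewrite mem_iota /=.
    rewrite mem_iota /= => id; move/colP: pE => /(_ (Ordinal id)); rewrite !mxE /= => ->.
    by [].
  have seqE : [seq out_vec s k | k <- iota j (c - j)] =
      out_vec s j :: [seq out_vec s k | k <- iota j.+1 (c - j.+1)].
    by rewrite -(subnSK jc).
  apply: wp_if; rewrite /= E3 eqsE => E.
    apply: wp_store; split; first by rewrite writeE /= R3.
    split; first exact: off_write.
    by rewrite writeE /= seqE inE; case: (_ == _) E.
  apply: wp_skip; split=> //; split=> //.
  by rewrite F3 F1 seqE inE; case: (_ == _) E.
- by lia.
- move=> s' [ho F]; split=> //; rewrite F subn0 /output_list sc absz_nat.
  by [].
Qed.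

Lemma wp_append (s : memory) (c : nat) : s 0%N 0%N = c%:Z ->
  wp (append d) (d + 2) s (fun s' => [/\ off [:: 0; 1]%N s s', s' 0%N 0%N = c.+1%:Z &
    output_list d s' = rcons (output_list d s) (read_vec d s aP)]).
Proof.
move=> sc; rewrite (_ : d + 2 = (d * 1).+1 + 1)%N; last by lia.
pose Inv m s' := [/\ off [:: 0; 1]%N s s', s' 0%N 0%N = c%:Z,
  forall k, (k < c * d)%N -> s' 1%N k = s 1%N k &
  forall i, (i < m)%N -> s' 1%N (c * d + i)%N = s aP i].
apply: wp_seq; apply: (wp_weaken (@wp_unroll _ _ _ _ _ d _ 1 _ Inv _ _) (leqnn _)) => //.
  move=> i s1 id [ho1 c1 lo hi]; apply: wp_store.
  rewrite (@eval_out_cell _ _ _ c) //; split=> //.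
  - exact: off_write.
  - by move=> k kc; rewrite writeE /= ltn_eqF ?lo //; lia.
  - move=> j; rewrite ltnS writeE /= eqn_add2l leq_eqVlt => /orP[/eqP ->|ji].
      by rewrite eqxx ho1.
    by rewrite ltn_eqF ?hi.
move=> s1 [ho1 c1 lo hi]; apply: wp_store => /=; rewrite c1 (_ : c%:Z + 1 = c.+1%:Z); last by lia.
have iotaS : iota 0 c.+1 = rcons (iota 0 c) c by rewrite -[c.+1]addn1 iotaD /= cats1.
set s2 := write _ _ _ _; have s2c : s2 0%N 0%N = c.+1 by [].
split=> //; first exact: off_write.
rewrite /output_list sc s2c !absz_nat iotaS map_rcons.
congr rcons; last by apply/colP => i; rewrite !mxE /s2 writeE /= hi.
apply/eq_in_map => k; rewrite mem_iota /= => kc; apply/colP => i; rewrite !mxE /s2 writeE /= lo //.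
by have := ltn_ord i; move: (nat_of_ord i) => i'; nia.
Qed.

Definition collected (h : 'cV[int]_d) (s : memory) := W *m answer h \in output_list d s.

(** [S] is a list of admissible outputs. Together with [uniq], its size bounds the length of the
    output and hence the time of [scan]. *)
Definition collecting (S : seq 'cV[int]_d) (s : memory) := [/\ base s,
  uniq (output_list d s), {subset output_list d s <= S} & exists c : nat, s 0%N 0%N = c%:Z].

Lemma wp_collect (S : seq 'cV[int]_d) s : collecting S s ->
  W *m answer (read_vec d s aH) \in S ->
  wp (collect d) (query_bound + (size S * (d * 4 + 6) + 3 + (d + 3))) s (fun s' =>
    [/\ collecting S s', collected (read_vec d s aH) s',
        forall h, collected h s -> collected h s',
        forall i, s' aH i = s aH i & forall i, s' (aCnt i) 0%N = s (aCnt i) 0%N]).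
Proof.
move=> [sb su sS [c sc]] pS; set h := read_vec d s aH in pS *.
have size_out : (c <= size S)%N.
  by apply: leq_trans (uniq_leq_size su sS); rewrite size_map size_iota sc.
apply: wp_seq; apply: (wp_weaken (wp_answer sb) (leqnn _)) => s1 [ho1 _ P1].
have s1c : s1 0%N 0%N = c%:Z by rewrite ho1.
have out1 : output_list d s1 = output_list d s.
  by rewrite /output_list ho1 //; apply: eq_map => k; apply/colP => i; rewrite !mxE ho1.
apply: wp_seq; apply: (wp_weaken (wp_scan s1c)).
  by rewrite leq_add2r leq_mul2r size_out orbT.
move=> s2 [ho2]; rewrite P1 out1 => F2.
have s2c : s2 0%N 0%N = c%:Z by rewrite ho2.
have out2 : output_list d s2 = output_list d s.
  by rewrite -out1 /output_list ho2 //; apply: eq_map => k; apply/colP => i; rewrite !mxE ho2.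
have P2 : read_vec d s2 aP = W *m answer h.
  by rewrite -P1; apply/colP => i; rewrite !mxE ho2.
have b2 : base s2 by apply: base_off ho2 (base_off _ ho1 sb).
have HC2 : (forall i, s2 aH i = s aH i) /\ (forall i, s2 (aCnt i) 0%N = s (aCnt i) 0%N).
  split=> i; first by rewrite ho2 // ho1.
  by rewrite ho2 ?ho1 //; rewrite !inE /aCnt; lia.
rewrite [(d + 3)%N]addnS; apply: wp_if => /=; rewrite F2 => F.
  have pin : W *m answer h \in output_list d s by case: (_ \in _) F.
  exists 1%N, s2; split; [exact: ExecSkip|by lia|].
  case: HC2 => HC2H HC2C; split=> //.
  - by split; rewrite ?out2 //; exists c.
  - by rewrite /collected out2.
  - by move=> h'; rewrite /collected out2.
have pout : W *m answer h \notin output_list d s by case: (_ \in _) F.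
apply: (wp_weaken (wp_append s2c) (leqnn _)) => s3 [ho3 c3]; rewrite P2 out2 => out3.
have [HC2H HC2C] := HC2; split.
- split; last by exists c.+1.
  + move: b2 => [bN bW bP]; split; first by rewrite ho3.
      by move=> i j; rewrite ho3 ?bW // !inE /aRow; lia.
    by move=> i im; rewrite ho3 ?bP // !inE /aPow; lia.
  + by rewrite out3 rcons_uniq pout.
  + by move=> p; rewrite out3 mem_rcons inE => /orP[/eqP ->|/sS].
- by rewrite /collected out3 mem_rcons mem_head.
- by move=> h'; rewrite /collected out3 mem_rcons inE => ->; rewrite orbT.
- by move=> i; rewrite ho3 // HC2H.
- by move=> i; rewrite ho3 ?HC2C // !inE /aCnt; lia.
Qed.

End Bodies.

Section Stability.
Variables (d n : nat) (lin : 'rV[int]_n -> 'cV[int]_n) (W : 'M[int]_(d, n)) (Y : nat).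

Lemma output_list_write s a k z : (1 < a)%N -> output_list d (write s a k z) = output_list d s.
Proof.
by case: a => [|[|a]].
Qed.

Lemma read_vec_write m s a b k z : a != b -> read_vec m (write s b k z) a = read_vec m s a.
Proof. by move=> ab; apply/colP => i; rewrite !mxE writeE (negbTE ab). Qed.

Lemma collecting_loop_stable S : loop_stable (collecting W Y S).
Proof.
move=> s a k z aE [sb su sS [c sc]].
have a1 : (1 < a)%N by case: aE => [->|[i ->]].
split; rewrite ?output_list_write //; first exact: base_loop_stable.
by exists c; rewrite writeE ltn_eqF // ltnW.
Qed.

Lemma collected_loop_stable h : loop_stable (collected lin W h).
Proof.
move=> s a k z aE; rewrite /collected output_list_write //.
by case: aE => [->|[i ->]].
Qed.

End Stability.

Section Improve.
Variables (R : realType) (d n : nat).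
Variable lin : 'rV[int]_n -> 'cV[int]_n.
Variables (f : 'cV[R]_d -> R) (cmp : 'cV[R]_d -> 'cV[R]_d -> bool).
Hypothesis cmpP : comparison_oracle f cmp.
Local Notation wp := (wp lin cmp).
Variables (W : 'M[int]_(d, n)) (Y : nat) (S : set 'cV[int]_n).
Hypothesis linS : forall w, S (lin w).

Lemma wp_copy a b (s : memory) : s aN 0%N = n%:Z -> a \notin [:: aJ; b] ->
  b \notin [:: aJ; aN] -> wp (copy a b) (n * 3 + 2) s (fun s' =>
    off [:: aJ; b] s s' /\ forall k, (k < n)%N -> s' b k = s a k).
Proof.
move=> sN; rewrite !inE !negb_or => /andP[aJ' ab] /andP[bJ bN].
pose Inv j s' := off [:: aJ; b] s s' /\ forall k, (j <= k < n)%N -> s' b k = s a k.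
apply: (wp_weaken (@wp_loop _ _ _ _ _ _ (Var aN) _ 1 n s Inv sN _ _)) => //.
- split=> [|k]; last by lia.
  by apply: off_write => //; rewrite !inE eqxx.
- move=> j s' jn [ho v] s'j; apply: wp_store => /=; split; first by rewrite writeE eq_sym (negbTE bJ).
  split=> [|k /andP[]].
    by do 2?apply: off_write => //; rewrite !inE eqxx ?orbT.
  rewrite writeE eqxx /= leq_eqVlt => /orP[/eqP <- _|jk kn].
    by rewrite eqxx writeE (negbTE aJ') /= ho // !inE negb_or aJ' ab.
  by rewrite gtn_eqF // writeE (negbTE bJ) /= v // jk.
Qed.

Definition keep_time := (d.+1 + (n * 3 + 2))%N.

Lemma wp_keep (s : memory) : s aN 0%N = n%:Z ->
  wp (keep d) keep_time s (fun s' => [/\ off [:: aBP; aJ; aBX] s s',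
    read_vec d s' aBP = read_vec d s aP & read_vec n s' aBX = read_vec n s aX]).
Proof.
move=> sN; rewrite /keep_time -[X in X.+1]muln1; apply: wp_seq.
pose Inv m s' := off [:: aBP] s s' /\ forall i, (i < m)%N -> s' aBP i = s aP i.
apply: (wp_weaken (@wp_unroll _ _ _ _ _ d _ 1 _ Inv _ _) (leqnn _)) => //.
  move=> i s' id [ho v]; apply: wp_store => /=; split; first exact: off_write.
  move=> j; rewrite ltnS writeE /= leq_eqVlt => /orP[/eqP ->|ji].
    by rewrite eqxx ho.
  by rewrite ltn_eqF ?v.
move=> s1 [ho1 v1].
have s1N : s1 aN 0%N = n%:Z by rewrite ho1.
apply: (wp_weaken (wp_copy (a := aX) (b := aBX) s1N _ _) (leqnn _)) => // s2 [ho2 v2]; split.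
- move=> a k; rewrite !inE !negb_or => /and3P[a1 a2 a3].
  by rewrite ho2 ?ho1 // !inE ?negb_or ?a2.
- by apply/colP => i; rewrite !mxE ho2 // v1.
- by apply/colP => i; rewrite !mxE v2 // ho1.
Qed.

Definition best (s : memory) := [/\ base W Y s, S (read_vec n s aBX) &
  read_vec d s aBP = W *m read_vec n s aBX].

Definition dominated (h : 'cV[int]_d) (s : memory) :=
  f (to_real R (W *m answer lin W h)) <= f (to_real R (read_vec d s aBP)).

Lemma best_loop_stable : loop_stable best.
Proof.
move=> s a k z aE [sb sS sP].
have [a1 a2] : aBX != a /\ aBP != a by case: aE => [->|[i ->]].
by split; rewrite ?read_vec_write //; exact: base_loop_stable.
Qed.

Lemma dominated_loop_stable h : loop_stable (dominated h).
Proof.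
move=> s a k z aE; rewrite /dominated read_vec_write //.
by case: aE => [->|[i ->]].
Qed.

(** Whatever functional stands in [aH], the oracle answers with a point of [S], which gives the
    comparisons a first candidate. *)
Lemma wp_first_best s : base W Y s ->
  wp (Seq (query d) (keep d)) (query_bound W + keep_time) s best.
Proof.
move=> sb; apply: wp_seq; apply: (wp_weaken (wp_answer lin cmp sb) (leqnn _)) => s1 [ho1 X1 P1].
have b1 : base W Y s1 by exact: base_off ho1 sb.
have [s1N _ _] := b1.
apply: (wp_weaken (wp_keep s1N) (leqnn _)) => s2 [ho2 P2 X2]; split.
- exact: base_off ho2 b1.
- by rewrite X2 X1; exact: linS.
- by rewrite P2 X2 P1 X1.
Qed.

Lemma wp_improve s : best s ->
  wp (improve d) (query_bound W + (d.+1 + keep_time.+1)) s (fun s' =>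
    [/\ best s', dominated (read_vec d s aH) s',
        forall h, dominated h s -> dominated h s',
        forall i, s' aH i = s aH i & forall i, s' (aCnt i) 0%N = s (aCnt i) 0%N]).
Proof.
move=> [sb sS sP]; set h := read_vec d s aH.
apply: wp_seq; apply: (wp_weaken (wp_answer lin cmp sb) (leqnn _)) => s1 [ho1 X1 P1].
apply: wp_seq; exists d.+1; eexists; split; [exact: ExecCmpOracle|by []|].
rewrite [eval _ _]/= [`|_|%N]/=; set b := cmp _ _; set s2 := write _ _ _ _.
have ho2 : off [:: aFlag] s1 s2 by exact: off_write.
have cntF i D : all (fun a => a < 20)%N D -> aCnt i \notin D.
  by move=> /allP H; apply/negP => /H; rewrite /aCnt; lia.
have b2 : base W Y s2 by apply: base_off ho2 (base_off _ ho1 sb).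
have [s2N _ _] := b2.
have BP2 : read_vec d s1 aBP = read_vec d s aBP by apply/colP => i; rewrite !mxE ho1.
have bE : b = (f (to_real R (read_vec d s aBP)) < f (to_real R (W *m answer lin W h))).
  by rewrite /b cmpP BP2 P1.
have flag : eval s2 (Var aFlag) = b%:Z by [].
apply: wp_if; rewrite flag => fl.
  have lt : f (to_real R (read_vec d s aBP)) < f (to_real R (W *m answer lin W h)).
    by rewrite -bE; case: (b) fl.
  apply: (wp_weaken (wp_keep s2N) (leqnn _)) => s3 [ho3 P3 X3].
  have P3E : read_vec d s3 aBP = W *m answer lin W h.
    by rewrite P3 -P1; apply/colP => i; rewrite !mxE ho2.
  have X3E : read_vec n s3 aBX = answer lin W h.
    by rewrite X3 -X1; apply/colP => i; rewrite !mxE ho2.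
  split.
  - split; first exact: base_off ho3 b2.
      by rewrite X3E; exact: linS.
    by rewrite P3E X3E.
  - by rewrite /dominated P3E.
  - by move=> h'; rewrite /dominated P3E => /le_lt_trans /(_ lt) /ltW.
  - by move=> i; rewrite ho3 // ho2 // ho1.
  - by move=> i; rewrite ho3 ?cntF // ho2 ?cntF // ho1 ?cntF.
have ge : f (to_real R (W *m answer lin W h)) <= f (to_real R (read_vec d s aBP)).
  by rewrite leNgt -bE; case: (b) fl.
have BP3 : read_vec d s2 aBP = read_vec d s aBP by rewrite -BP2; apply/colP => i; rewrite !mxE ho2.
have BX3 : read_vec n s2 aBX = read_vec n s aBX by apply/colP => i; rewrite !mxE ho2 ?ho1.
exists 1%N, s2; split; [exact: ExecSkip|by []|split].
- by split; rewrite ?BP3 ?BX3.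
- by rewrite /dominated BP3.
- by move=> h'; rewrite /dominated BP3.
- by move=> i; rewrite ho2 // ho1.
- by move=> i; rewrite ho2 ?cntF // ho1 ?cntF.
Qed.

End Improve.

(** * Polynomial running times *)

Section PolynomialBounds.

(** Restricting to positive [X] lets exponents be raised, so sums can be bounded by a single
    monomial. *)
Definition poly_bounded (F : nat -> nat) :=
  exists C k, forall X, (0 < X)%N -> (F X <= C * X ^ k)%N.

Lemma poly_bounded_const c : poly_bounded (fun=> c).
Proof. by exists c, 0%N => X _; rewrite muln1. Qed.

Lemma poly_bounded_id : poly_bounded id.
Proof. by exists 1%N, 1%N => X _; rewrite mul1n expn1. Qed.

Lemma poly_bounded_add F G : poly_bounded F -> poly_bounded G ->
  poly_bounded (fun X => F X + G X)%N.
Proof.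
move=> [C [k FC]] [D [l GD]]; exists (C + D)%N, (k + l)%N => X X0.
rewrite mulnDl; apply: leq_add.
  by apply: leq_trans (FC X X0) _; rewrite leq_mul2l leq_pexp2l ?leq_addr ?orbT.
by apply: leq_trans (GD X X0) _; rewrite leq_mul2l leq_pexp2l ?leq_addl ?orbT.
Qed.

Lemma poly_bounded_mul F G : poly_bounded F -> poly_bounded G ->
  poly_bounded (fun X => F X * G X)%N.
Proof.
move=> [C [k FC]] [D [l GD]]; exists (C * D)%N, (k + l)%N => X X0.
by rewrite expnD mulnACA leq_mul ?FC ?GD.
Qed.

Lemma poly_bounded_exp F m : poly_bounded F -> poly_bounded (fun X => F X ^ m)%N.
Proof.
move=> FP; elim: m => [|m IH]; first exact: (poly_bounded_const 1).
have [C [k H]] := poly_bounded_mul FP IH; exists C, k => X X0; rewrite expnS; exact: H.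
Qed.

Lemma poly_boundedS F : poly_bounded F -> poly_bounded (fun X => (F X).+1).
Proof.
move=> FP; have [C [k H]] := poly_bounded_add FP (poly_bounded_const 1).
by exists C, k => X X0; rewrite -addn1; exact: H.
Qed.

Lemma poly_bounded_nest_time N T m : poly_bounded N -> poly_bounded T ->
  poly_bounded (fun X => nest_time (N X) (T X) m).
Proof.
move=> NP TP; elim: m => //= m IH.
apply: poly_bounded_add (poly_bounded_const 3).
apply: poly_bounded_mul.
  exact: poly_bounded_add (poly_bounded_mul (poly_bounded_const 2) NP) (poly_bounded_const 1).
apply/poly_boundedS/poly_boundedS; exact: poly_bounded_add IH (poly_bounded_const 1).
Qed.

Lemma leq_nest_time N N' T T' m : (N <= N')%N -> (T <= T')%N ->
  (nest_time N T m <= nest_time N' T' m)%N.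
Proof.
move=> NN TT; elim: m => //= m IH.
by rewrite leq_add2r leq_mul // ?leq_add2r ?leq_mul2l // !ltnS leq_add2r.
Qed.

End PolynomialBounds.

Ltac poly_bounded_tac := repeat first
  [ exact: poly_bounded_const | exact: poly_bounded_id
  | apply: poly_bounded_nest_time | apply: poly_bounded_exp | apply: poly_boundedS
  | apply: poly_bounded_add | apply: poly_bounded_mul ].

(** * Correctness *)

Section Correctness.
Variables (R : realType) (d n : nat).
Hypothesis d_gt0 : (0 < d)%N.
Variables (s : seq 'cV[int]_n) (W : 'M[int]_(d, n)) (e : nat).
Variable lin : 'rV[int]_n -> 'cV[int]_n.
Local Notation r := (to_real R).
Local Notation P := (convex_hull (to_real R @` [set` s])).
Hypotheses (Pe : edge_bound P e) (linP : linear_optimization_oracle [set` s] lin).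
Local Notation M := (mx_norm_oo W).
Local Notation answer := (answer lin W).

Let k := maxn 1 (e * M).
Let k_gt0 : (0 < k)%N. Proof. by rewrite /k; lia. Qed.
Let ek : (e * M <= k)%N. Proof. exact: leq_maxr. Qed.

Section Grid.
Variable Y : nat.
Hypothesis Yb : (e + d`!.+1 + M <= Y)%N.

(** The reason for squaring [Y]: [k] is at most [1 + e M], and [Y] is at least [e + M + 2], whose
    square exceeds [2 + 2 e M]. *)
Let kY : (2 * k < Y ^ 2)%N.
Proof.
have f0 := fact_gt0 d.
have : ((e + M + 2) * (e + M + 2) <= Y ^ 2)%N by rewrite -mulnn leq_mul //; lia.
have : (k <= 1 + e * M)%N by rewrite /k; move: (e * M)%N => em; lia.
by move: k (M) => k' m; nia.
Qed.

(** One of the [d] factors [Y^2] absorbs [d!], the others absorb one [k] each. *)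
Let dY : (d`! * k ^ d.-1 <= (Y ^ 2) ^ d)%N.
Proof.
rewrite -[in leqRHS](prednK d_gt0) expnS; apply: leq_mul.
  by apply: (@leq_trans Y); [lia|rewrite -mulnn; nia].
by have [->//|d1] := posnP d.-1; rewrite leq_exp2r //; lia.
Qed.

(** The oracle may choose another maximizer than [x], but only one with the same image. *)
Lemma answer_unique_max h x : unique_max s W (r h^T) x -> W *m answer h = W *m x.
Proof.
move=> [xs xU]; have [as_ amax] := linP (h^T *m W).
apply/eqP; apply: contraT => /(xU _ as_).
by rewrite !ev_to_real !mulmxA ltr_int ltNge amax.
Qed.

Lemma grid_answer_vertex h : on_grid (Y ^ 2) h ->
  vertices (image_polytope R W [set` s]) (r (W *m answer h)).
Proof.
move=> hg; have [as_ amax] := linP (h^T *m W).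
apply/verticesP; exists (answer h), (r h^T); split=> //.
exact: (grid_unique_max Pe ek kY hg as_ amax).
Qed.

Lemma unique_max_grid_answer (h : 'rV[R]_d) x : unique_max s W h x ->
  exists2 h', on_grid (Y ^ 2) h' & W *m answer h' = W *m x.
Proof.
move=> /(unique_max_grid Pe ek kY k_gt0 dY) [h' hg hx].
by exists h' => //; exact: answer_unique_max.
Qed.

(** Indexed by the coefficient vectors [a] rather than by the functionals, so that its size is that
    of a box. *)
Definition grid_answers : seq 'cV[int]_d :=
  [seq W *m answer (\col_i (((Y ^ 2) ^ i)%N%:Z + ((Y ^ 2) ^ d)%N%:Z * a i 0)) |
     a : 'cV[int]_d <- box d ((Y ^ 2) ^ d)].

Lemma mem_grid_answers h : on_grid (Y ^ 2) h -> W *m answer h \in grid_answers.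
Proof.
move=> hg.
have /boolp.choice [a aP] : forall i : 'I_d, exists a : int, (`|a| <= (Y ^ 2) ^ d)%N /\
    h i 0 = ((Y ^ 2) ^ i)%N%:Z + ((Y ^ 2) ^ d)%N%:Z * a.
  by move=> i; have [a a1 a2] := hg i; exists a.
apply/mapP; exists (\col_i a i).
  by apply/boxP => i; rewrite mxE; have [] := aP i.
congr (W *m answer _); apply/colP => i; rewrite !mxE; by have [] := aP i.
Qed.

Lemma size_grid_answers : size grid_answers = ((2 * (Y ^ 2) ^ d).+1 ^ d)%N.
Proof. by rewrite size_map size_box. Qed.

End Grid.

(** In these bounds all parameters are replaced by the single [X = n + e + M + 1]; [base_bound]
    bounds [Y], and [step_bound] bounds the grid step [N]. *)
Definition base_bound (X : nat) := (X + d`!.+1 + X * d * X)%N.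
Definition step_bound (X : nat) := ((base_bound X ^ 2) ^ d)%N.
Definition collect_bound (X : nat) :=
  (query_time d X X + ((2 * step_bound X).+1 ^ d * (d * 4 + 6) + 3 + (d + 3)))%N.
Definition vertices_bound (X : nat) :=
  (init_time d X (base_bound X) + nest_time (step_bound X) (collect_bound X) d)%N.
Definition improve_bound (X : nat) :=
  (query_time d X X + (d.+1 + (keep_time d X).+1))%N.
Definition maximum_bound (X : nat) :=
  (init_time d X (base_bound X) + (query_time d X X + keep_time d X +
   (nest_time (step_bound X) (improve_bound X) d + (X * 3 + 2))))%N.

Local Notation X := (n + e + M + 1)%N.

Let ymax_bound : (e + d`!.+1 + n * d * M <= base_bound X)%N.
Proof. by rewrite /base_bound !leq_add ?leq_mul //; lia. Qed.

Let leq_init_time : (init_time d n (e + d`!.+1 + n * d * M) <= init_time d X (base_bound X))%N.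
Proof. by rewrite /init_time !leq_add ?leq_mul ?leq_add ?leq_mul //; lia. Qed.

Let leq_query_time : (query_time d n M <= query_time d X X)%N.
Proof. by rewrite /query_time !leq_add ?leq_mul ?leq_add ?leq_mul ?leq_add ?leq_mul //; lia. Qed.

Let leq_step Y : (Y <= e + d`!.+1 + n * d * M)%N -> ((Y ^ 2) ^ d <= step_bound X)%N.
Proof.
move=> YX; rewrite /step_bound leq_exp2r // leq_exp2r //.
exact: leq_trans YX ymax_bound.
Qed.

Lemma vertices_program_correct : exists t m,
  [/\ exec lin (@no_comparison R d) (Seq (init d) (nest d (collect d) d)) t (input W e) m,
      (t <= vertices_bound X)%N, uniq (output_list d m) &
      [set r v | v in [set` output_list d m]] = vertices (image_polytope R W [set` s])].
Proof.
suff [t [m [ex tX [um Hm]]]] : wp lin (@no_comparison R d) (Seq (init d) (nest d (collect d) d))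
    (vertices_bound X) (input W e) (fun m => uniq (output_list d m) /\
    [set r v | v in [set` output_list d m]] = vertices (image_polytope R W [set` s])).
  by exists t, m.
apply: wp_seq; apply: (wp_weaken (wp_init _ _ W e) leq_init_time).
move=> s0 [Y [/andP[Y1 Y2] s0N s0W s0P s00]].
(* Filtering the grid answers by being a vertex makes one list do two tasks: soundness of the output
   and a polynomial bound on its length. *)
have c0 : collecting W Y [seq p <- grid_answers Y | `[<vertices (image_polytope R W [set` s]) (r p)>]] s0.
  split=> //; last by exists 0%N.
  - by rewrite /output_list s00.
  - by move=> p; rewrite /output_list s00.
have body m : collecting W Y [seq p <- grid_answers Y | `[<vertices (image_polytope R W [set` s]) (r p)>]] m ->
    on_grid (Y ^ 2) (read_vec d m aH) ->
    wp lin (@no_comparison R d) (collect d) (collect_bound X) m (fun m' =>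
    [/\ collecting W Y [seq p <- grid_answers Y | `[<vertices (image_polytope R W [set` s]) (r p)>]] m',
        collected lin W (read_vec d m aH) m',
        forall h, collected lin W h m -> collected lin W h m',
        forall i, m' aH i = m aH i & forall i, m' (aCnt i) 0%N = m (aCnt i) 0%N]).
  move=> cm hg; apply: (wp_weaken (wp_collect _ cm _)).
  - rewrite mem_filter mem_grid_answers // andbT; apply/asboolP.
    exact: (grid_answer_vertex Y1 hg).
  - rewrite /collect_bound leq_add ?leq_query_time // !leq_add2r leq_mul2r; apply/orP; right.
    rewrite size_filter; apply: leq_trans (count_size _ _) _.
    by rewrite size_grid_answers leq_exp2r // ltnS leq_mul2l leq_step ?orbT.
  - by [].
apply: (wp_weaken (wp_nest_all (cov := collected lin W) _ _ _ body c0)).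
- exact: collecting_loop_stable.
- exact: collected_loop_stable.
- by move=> m [[_ _]].
- by apply: leq_nest_time => //; exact: leq_step.
move=> m [[_ um mS _] cm]; split=> //.
apply/seteqP; split=> [u [p /= /mS]|u]; first by rewrite mem_filter => /andP[/asboolP + _] => + <-.
move=> /verticesP [x [h [hx ->]]].
have [h' hg' hxE] := unique_max_grid_answer Y1 hx.
by exists (W *m x) => //=; rewrite -hxE; exact: cm.
Qed.

Variables (f : 'cV[R]_d -> R) (cmp : 'cV[R]_d -> 'cV[R]_d -> bool).
Hypotheses (f_convex : @convex_function R 'cV[R]_d setT f) (cmpP : comparison_oracle f cmp).

Lemma maximum_program_correct : exists t m,
  [/\ exec lin cmp (Seq (init d) (Seq (Seq (query d) (keep d))
        (Seq (nest d (improve d) d) (copy aBX 1)))) t (input W e) m,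
      (t <= maximum_bound X)%N, output_vec n m \in s &
      forall x, x \in s -> f (r (W *m x)) <= f (r (W *m output_vec n m))].
Proof.
suff [t [m [ex tX [ms Hm]]]] : wp lin cmp (Seq (init d) (Seq (Seq (query d) (keep d))
        (Seq (nest d (improve d) d) (copy aBX 1))))
    (maximum_bound X) (input W e) (fun m => output_vec n m \in s /\
      forall x, x \in s -> f (r (W *m x)) <= f (r (W *m output_vec n m))).
  by exists t, m.
apply: wp_seq; apply: (wp_weaken (wp_init _ _ W e) leq_init_time).
move=> s0 [Y [/andP[Y1 Y2] s0N s0W s0P _]].
have b0 : base W Y s0 by [].
have linS w : [set` s] (lin w) by have [] := linP w.
apply: wp_seq; apply: (wp_weaken (wp_first_best cmp linS b0)).
  by rewrite leq_add ?leq_query_time // /keep_time; lia.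
move=> s1 best1.
have body m : best W Y [set` s] m -> on_grid (Y ^ 2) (read_vec d m aH) ->
    wp lin cmp (improve d) (improve_bound X) m (fun m' =>
    [/\ best W Y [set` s] m', dominated lin f W (read_vec d m aH) m',
        forall h, dominated lin f W h m -> dominated lin f W h m',
        forall i, m' aH i = m aH i & forall i, m' (aCnt i) 0%N = m (aCnt i) 0%N]).
  move=> bm _; apply: (wp_weaken (wp_improve cmpP linS bm)) => //.
  by rewrite /improve_bound leq_add ?leq_query_time // /keep_time; lia.
apply: wp_seq.
apply: (wp_weaken (wp_nest_all (cov := dominated lin f W) _ _ _ body best1)).
- exact: best_loop_stable.
- exact: dominated_loop_stable.
- by move=> m [[_ _]].
- by apply: leq_nest_time => //; exact: leq_step.
move=> s2 [[[s2N _ _] s2S s2P] dom2].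
apply: (wp_weaken (wp_copy lin cmp (a := aBX) (b := 1) s2N _ _)) => //; first by lia.
move=> s3 [_ v3].
have -> : output_vec n s3 = read_vec n s2 aBX by apply/colP => i; rewrite !mxE v3.
(* The value at [x] is at most that at some unique maximizer [x1]; a grid functional returns the
   image of [x1], and the stored candidate dominates that answer. *)
split=> // x xs; have [x1 [h [hx1 le]]] := convex_max_unique W f_convex xs.
have [h' hg' hxE] := unique_max_grid_answer Y1 hx1.
by apply: le_trans le _; rewrite -hxE -s2P; exact: dom2.
Qed.

End Correctness.

Theorem theorem2p3 (R : realType) (d : nat) (d_gt0 : (0 < d)%N) :
  (exists C : nat,
     forall (n : nat) (S : set 'cV[int]_n) (W : 'M[int]_(d, n)),
       finite_set S ->
       vertices (image_polytope R W S) #<=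
         `I_(C * maxn 1 (set_edge_complexity R S * mx_norm_oo W)
                   ^ (d * (d - 1)))%N)
  /\
  (exists (p : prog) (C k : nat),
     forall (n : nat) (S : set 'cV[int]_n) (W : 'M[int]_(d, n)) (e : nat)
            (lin : 'rV[int]_n -> 'cV[int]_n),
       finite_set S ->
       linear_optimization_oracle S lin ->
       (set_edge_complexity R S <= e)%N ->
       exists (t : nat) (s : memory),
         [/\ exec lin (@no_comparison R d) p t (input W e) s,
             (t <= C * (n + e + mx_norm_oo W + 1) ^ k)%N,
             uniq (output_list d s) &
             [set to_real R v | v in [set` output_list d s]]
               = vertices (image_polytope R W S)])
  /\
  (exists (p : prog) (C k : nat),
     forall (n : nat) (S : set 'cV[int]_n) (W : 'M[int]_(d, n)) (e : nat)
            (lin : 'rV[int]_n -> 'cV[int]_n)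
            (f : 'cV[R]_d -> R) (cmp : 'cV[R]_d -> 'cV[R]_d -> bool),
       finite_set S ->
       linear_optimization_oracle S lin ->
       (set_edge_complexity R S <= e)%N ->
       @convex_function R 'cV[R]_d setT f ->
       comparison_oracle f cmp ->
       exists (t : nat) (s : memory),
         [/\ exec lin cmp p t (input W e) s,
             (t <= C * (n + e + mx_norm_oo W + 1) ^ k)%N,
             S (output_vec n s) &
             forall x, S x -> f (to_real R (W *m x))
                              <= f (to_real R (W *m output_vec n s))]).
Proof.
have ybP : poly_bounded (base_bound d) by rewrite /base_bound; poly_bounded_tac.
have sbP : poly_bounded (step_bound d) by apply/poly_bounded_exp/poly_bounded_exp.
split; [|split].
- exists ((3 * d`!) ^ d)%N => n S W /finite_seqP [s ->].
  rewrite subn1; apply: card_vertices_box (leq_maxr _ _) _; last by lia.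
  exact: edge_complexityP.
- have [C [k Ck]] : poly_bounded (vertices_bound d).
    by rewrite /vertices_bound /collect_bound /init_time /query_time; poly_bounded_tac.
  exists (Seq (init d) (nest d (collect d) d)), C, k => n S W e lin /finite_seqP [s ->] linP eb.
  have [t [m [ex tX um mV]]] := vertices_program_correct d_gt0 W (edge_complexityP eb) linP.
  by exists t, m; split=> //; apply: leq_trans tX (Ck _ _); lia.
- have [C [k Ck]] : poly_bounded (maximum_bound d).
    by rewrite /maximum_bound /improve_bound /keep_time /init_time /query_time; poly_bounded_tac.
  exists (Seq (init d) (Seq (Seq (query d) (keep d)) (Seq (nest d (improve d) d) (copy aBX 1)))), C, k.
  move=> n S W e lin f cmp /finite_seqP [s ->] linP eb fc cmpP.
  have [t [m [ex tX ms mM]]] := maximum_program_correct d_gt0 W (edge_complexityP eb) linP fc cmpP.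
  by exists t, m; split=> //; apply: leq_trans tX (Ck _ _); lia.
Qed.
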